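(* Basic cohomology of Lie groupoids is Morita invariant: if $\mathsf{G}$ and $\mathsf{H}$ are Morita equivalent Lie groupoids, then $H^\bullet_{\mathrm{basic}}(\mathsf{G},\mathbb{R})\cong H^\bullet_{\mathrm{basic}}(\mathsf{H},\mathbb{R})$.
   Context: Let $\mathsf{G}=(s,t:\mathsf{G}_1\rightrightarrows\mathsf{G}_0)$ be a Lie groupoid (not necessarily proper) with Lie algebroid $(A,\rho)$, $\rho:A\to T\mathsf{G}_0$ the anchor; its image at $p$ is the tangent space to the orbit through $p$. An arrow $g$ from $p=s(g)$ to $q=t(g)$ acts as a linear map $N_p\to N_q$ between the normal spaces to the orbit, $N_p=T_p\mathsf{G}_0/\rho(A_p)$: $g\cdot[\dot\delta(0)]=[\frac{d}{d\tau}|_{\tau=0}t(\gamma(\tau))]$ for a smooth curve $\delta$ in $\mathsf{G}_0$ through $p$ and a smooth curve $\gamma$ in $\mathsf{G}_1$ with $\gamma(0)=g$, $s\circ\gamma=\delta$. A differential form $\alpha\in\Omega^k(\mathsf{G}_0)$ is basic if (B1) $\iota_{\rho(X)}\alpha=0$ for all $X\in\Gamma^\infty(A)$, so that $\alpha$ induces alternating forms on the normal spaces $N_p$, and (B2) $\alpha$ is $\mathsf{G}$-invariant, i.e. $\alpha_{t(g)}(g v_1,\ldots,g v_k)=\alpha_{s(g)}(v_1,\ldots,v_k)$ for all $g\in\mathsf{G}_1$, $v_i\in N_{s(g)}$. The de Rham differential preserves basic forms; $H^\bullet_{\mathrm{basic}}(\mathsf{G},\mathbb{R})$ is the cohomology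 of the complex $(\Omega^\bullet_{\mathrm{basic}}(\mathsf{G}),d)$ of basic forms. A morphism $f:\mathsf{G}\to\mathsf{H}$ of Lie groupoids is a weak equivalence if (ES) $t\circ\mathrm{pr}_1:\mathsf{H}_1\times_{\mathsf{H}_0}\mathsf{G}_0\to\mathsf{H}_0$ is a surjective submersion (fiber product over the source map of $\mathsf{H}$ and $f$), and (FF) $\mathsf{G}_1$ is the fiber product of $(s,t):\mathsf{H}_1\to\mathsf{H}_0\times\mathsf{H}_0$ and $(f,f):\mathsf{G}_0\times\mathsf{G}_0\to\mathsf{H}_0\times\mathsf{H}_0$ via $f$ and $(s,t)$. Two Lie groupoids are Morita equivalent if there are a Lie groupoid $\mathsf{K}$ and weak equivalences $\mathsf{K}\to\mathsf{G}$, $\mathsf{K}\to\mathsf{H}$. *)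

(* Defs.v *)
From HB Require Import structures.
From mathcomp Require Import all_boot all_order all_algebra.
From mathcomp Require Import generic_quotient ring_quotient.
From mathcomp Require Import all_classical all_reals all_analysis.

Set Implicit Arguments.
Unset Strict Implicit.
Unset Printing Implicit Defensive.
Import Order.TTheory GRing.Theory Num.Theory.
Import numFieldNormedType.Exports.

Local Open Scope classical_set_scope.
Local Open Scope ring_scope.

(* C^k functions on an open set U (values of f outside U play no role). *)
Fixpoint Ck_on (R : realType) (V W : normedModType R) (k : nat) (U : set V)
    (f : V -> W) : Prop :=
  match k with
  | 0 => forall x, U x -> {for x, continuous f}
  | k'.+1 => (forall x, U x -> differentiable f x) /\
             forall v, Ck_on k' U (fun x => 'd f x v)
  end.

Definition smooth_on (R : realType) (V W : normedModType R) (U : set V)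
  (f : V -> W) : Prop := forall k, Ck_on k U f.

Definition smooth_at (R : realType) (V W : normedModType R) (f : V -> W)
  (x : V) : Prop := exists U : set V, [/\ open U, U x & smooth_on U f].

(* A chart is a partial homeomorphism onto an open subset of R^n; [fwd] and
   [bwd] carry irrelevant values outside [dom] and [cod]. *)
Record chart (R : realType) (T : topologicalType) (n : nat) := Chart {
  dom : set T;
  cod : set 'rV[R]_n;
  fwd : T -> 'rV[R]_n;
  bwd : 'rV[R]_n -> T;
  dom_open : open dom;
  cod_open : open cod;
  fwd_cod : forall p, dom p -> cod (fwd p);
  bwd_dom : forall x, cod x -> dom (bwd x);
  fwdK : forall p, dom p -> bwd (fwd p) = p;
  bwdK : forall x, cod x -> fwd (bwd x) = x;
  fwd_continuous : forall p, dom p -> {for p, continuous fwd};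
  bwd_continuous : forall x, cod x -> {for x, continuous bwd}
}.

(* Smooth manifolds are finite-dimensional, without boundary, Hausdorff and
   second countable. The atlas need not be maximal. [chart_at p] is a
   distinguished chart around p, used to give coordinates to T_pM. *)
Record manifold (R : realType) := Manifold {
  mcarrier :> topologicalType;
  mdim : nat;
  atlas : set (chart R mcarrier mdim);
  chart_at : mcarrier -> chart R mcarrier mdim;
  chart_at_atlas : forall p, atlas (chart_at p);
  chart_at_dom : forall p, dom (chart_at p) p;
  atlas_smooth : forall c c', atlas c -> atlas c' ->
    smooth_on (cod c `&` bwd c @^-1` dom c') (fwd c' \o bwd c);
  manifold_hausdorff : hausdorff_space mcarrier;
  manifold_second_countable : @second_countable mcarrier
}.

(* The tangent space T_pM is the space R^n of coordinates of tangent vectors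
   in the distinguished chart [chart_at p]; an element of [tangent M] only
   acquires a meaning together with a base point. *)
Notation tangent M := 'rV_(mdim M) (only parsing).

Definition coord (R : realType) (M : manifold R) (p : M) : tangent M :=
  fwd (chart_at p) p.

Definition local_map (R : realType) (M N : manifold R) (f : M -> N) (p : M) :
    'rV[R]_(mdim M) -> 'rV[R]_(mdim N) :=
  fwd (chart_at (f p)) \o f \o bwd (chart_at p).

Definition smooth_map (R : realType) (M N : manifold R) (f : M -> N) : Prop :=
  forall p, {for p, continuous f} /\ smooth_at (local_map f p) (coord p).

(* The tangent map T_pM -> T_{f(p)}N. *)
Definition tmap (R : realType) (M N : manifold R) (f : M -> N) (p : M) :
    tangent M -> tangent N :=
  'd (local_map f p) (coord p).

Definition submersion (R : realType) (M N : manifold R) (f : M -> N) : Prop :=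
  smooth_map f /\ forall p w, exists v, tmap f p v = w.

(* Only the germ of gamma at 0 is constrained. *)
Definition smooth_curve (R : realType) (M : manifold R) (gamma : R -> M) :
    Prop :=
  (\forall tau \near (0 : R), {for tau, continuous gamma}) /\
  smooth_at (fwd (chart_at (gamma 0)) \o gamma) (0 : R).

(* The velocity at 0, a vector in T_{gamma(0)}M. *)
Definition velocity (R : realType) (M : manifold R) (gamma : R -> M) :
    tangent M :=
  derive1 (fwd (chart_at (gamma 0)) \o gamma) 0.

(* For p = c^-1(x): passage from the coordinates on T_pM given by the chart c
   to those given by [chart_at p]. *)
Definition to_tangent (R : realType) (M : manifold R)
    (c : chart R M (mdim M)) (x : 'rV[R]_(mdim M)) :
    'rV[R]_(mdim M) -> tangent M :=
  'd (fwd (chart_at (bwd c x)) \o bwd c) x.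

(* The inverse passage, from [chart_at p] to c. *)
Definition of_tangent (R : realType) (M : manifold R)
    (c : chart R M (mdim M)) (p : M) : tangent M -> 'rV[R]_(mdim M) :=
  'd (fwd c \o bwd (chart_at p)) (coord p).

(* The fiber product A x_C B in the category of smooth manifolds. *)
Definition is_fiber_product (R : realType) (A B C P : manifold R)
    (f : A -> C) (g : B -> C) (p1 : P -> A) (p2 : P -> B) : Prop :=
  [/\ smooth_map p1, smooth_map p2, forall z, f (p1 z) = g (p2 z) &
      forall (Q : manifold R) (q1 : Q -> A) (q2 : Q -> B),
        smooth_map q1 -> smooth_map q2 -> (forall z, f (q1 z) = g (q2 z)) ->
        exists! h : Q -> P,
          [/\ smooth_map h, forall z, p1 (h z) = q1 z &
              forall z, p2 (h z) = q2 z]].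

(* A possibly larger space than Omega^k(M): families (omega_p) of arbitrary
   functions (T_pM)^k -> R. Differential forms are singled out by [is_form]. *)
Definition preform (R : realType) (M : manifold R) (k : nat) : Type :=
  M -> ('I_k -> 'rV[R]_(mdim M)) -> R^o.

HB.instance Definition _ (R : realType) (M : manifold R) (k : nat) :=
  GRing.Lmodule.copy (preform M k) (M -> ('I_k -> 'rV[R]_(mdim M)) -> R^o).

Definition alternating_form (R : realType) (n k : nat)
    (a : ('I_k -> 'rV[R]_n) -> R) : Prop :=
  (forall v i (b : R) (x y : 'rV[R]_n),
     a (dfwith v i (b *: x + y)) = b * a (dfwith v i x) + a (dfwith v i y)) /\
  (forall v i j, i != j -> v i = v j -> a v = 0).

(* The expression of omega in the chart c: its value at the point x of cod c on
   vectors v_1, ..., v_k of R^n. *)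
Definition local_form (R : realType) (M : manifold R) (k : nat)
    (c : chart R M (mdim M)) (omega : preform M k)
    (v : 'I_k -> 'rV[R]_(mdim M)) (x : 'rV[R]_(mdim M)) : R :=
  omega (bwd c x) (fun i => to_tangent c x (v i)).

Definition is_form (R : realType) (M : manifold R) (k : nat)
    (omega : preform M k) : Prop :=
  (forall p, alternating_form (omega p)) /\
  (forall c v, atlas c -> smooth_on (cod c) (local_form c omega v)).

(* The de Rham differential, computed at p in the chart [chart_at p]:
   (d omega)(v_0, ..., v_k)
     = sum_i (-1)^i D_{v_i} (omega(v_0, ..., ^v_i, ..., v_k)). *)
Definition dR (R : realType) (M : manifold R) (k : nat) (omega : preform M k) :
    preform M k.+1 :=
  fun p v => \sum_(i < k.+1) (-1) ^+ i *
    'd (local_form (chart_at p) omega (fun j => v (lift i j))) (coord p) (v i).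

(* [mul g h] is the composite g h, meaningful only if src g = tgt h. *)
Record lie_groupoid (R : realType) := LieGroupoid {
  objs : manifold R;
  arrs : manifold R;
  src : arrs -> objs;
  tgt : arrs -> objs;
  unit_arr : objs -> arrs;
  inv_arr : arrs -> arrs;
  mul : arrs -> arrs -> arrs;
  src_submersion : submersion src;
  tgt_submersion : submersion tgt;
  unit_smooth : smooth_map unit_arr;
  inv_smooth : smooth_map inv_arr;
  mul_smooth : exists (P : manifold R) (p1 p2 : P -> arrs),
    is_fiber_product src tgt p1 p2 /\
    smooth_map (fun z => mul (p1 z) (p2 z));
  src_unit : forall p, src (unit_arr p) = p;
  tgt_unit : forall p, tgt (unit_arr p) = p;
  src_inv : forall g, src (inv_arr g) = tgt g;
  tgt_inv : forall g, tgt (inv_arr g) = src g;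
  src_mul : forall g h, src g = tgt h -> src (mul g h) = src h;
  tgt_mul : forall g h, src g = tgt h -> tgt (mul g h) = tgt g;
  mul_assoc : forall g h l, src g = tgt h -> src h = tgt l ->
    mul g (mul h l) = mul (mul g h) l;
  mul_unit_l : forall g, mul (unit_arr (tgt g)) g = g;
  mul_unit_r : forall g, mul g (unit_arr (src g)) = g;
  mul_inv_l : forall g, mul (inv_arr g) g = unit_arr (src g);
  mul_inv_r : forall g, mul g (inv_arr g) = unit_arr (tgt g)
}.

(* The fiber A_p = ker (T src) at the unit of p of the Lie algebroid. *)
Definition algebroid (R : realType) (G : lie_groupoid R) (p : objs G) :
    set (tangent (arrs G)) :=
  [set a : 'rV[R]_(mdim (arrs G)) | tmap (@src R G) (unit_arr p) a = 0].

Definition anchor (R : realType) (G : lie_groupoid R) (p : objs G) :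
    tangent (arrs G) -> tangent (objs G) :=
  tmap (@tgt R G) (unit_arr p).

Definition algebroid_section (R : realType) (G : lie_groupoid R)
    (X : objs G -> tangent (arrs G)) : Prop :=
  (forall p, algebroid p (X p)) /\
  (forall p, smooth_at
     (fun x => let q := bwd (chart_at p) x in
        of_tangent (chart_at (unit_arr p)) (unit_arr q) (X q))
     (coord p)).

(* Equality in the normal space N_p = T_p G_0 / rho(A_p). *)
Definition normal_eq (R : realType) (G : lie_groupoid R) (p : objs G)
    (v w : tangent (objs G)) : Prop :=
  exists a, algebroid p a /\ v - w = anchor p a.

(* [normal_act g v w]: g maps [v] in N_{src g} to [w] in N_{tgt g}. *)
Definition normal_act (R : realType) (G : lie_groupoid R) (g : arrs G)
    (v w : tangent (objs G)) : Prop :=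
  exists gamma : R -> arrs G,
    [/\ smooth_curve gamma, gamma 0 = g,
        normal_eq (src g) (velocity (fun tau => src (gamma tau))) v &
        normal_eq (tgt g) (velocity (fun tau => tgt (gamma tau))) w].

Definition interior (R : realType) (M : manifold R) (k : nat)
    (Y : M -> tangent M) (omega : preform M k.+1) : preform M k :=
  fun p v => omega p (fun i => oapp v (Y p) (unlift ord0 i)).

Definition horizontal (R : realType) (G : lie_groupoid R) (k : nat) :
    preform (objs G) k -> Prop :=
  match k with
  | 0 => fun _ => True
  | k'.+1 => fun omega => forall X, algebroid_section X ->
      interior (fun p => anchor p (X p)) omega = 0
  end.

(* Forms on normal spaces are evaluated on representatives. *)
Definition invariant (R : realType) (G : lie_groupoid R) (k : nat)
    (omega : preform (objs G) k) : Prop :=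
  forall (g : arrs G) (v w : 'I_k -> 'rV[R]_(mdim (objs G))),
    (forall i, normal_act g (v i) (w i)) -> omega (tgt g) w = omega (src g) v.

Definition basic (R : realType) (G : lie_groupoid R) (k : nat)
    (omega : preform (objs G) k) : Prop :=
  [/\ is_form omega, horizontal omega & invariant omega].

Lemma near_eq_differentiable (R : realType) (V W : normedModType R)
    (f g : V -> W) (x : V) :
  (\near x, f x = g x) -> differentiable f x -> differentiable g x.
Proof.
move=> fg /diff_locallyP [dfc /eqaddoP df].
have gx : g x = f x by rewrite (nbhs_singleton fg).
have gdf : g \o shift x = cst (g x) + 'd f x +o_ (0 : V) id.
  apply/eqaddoP => e e0.
  have fg0 : \forall h \near (0 : V), f (h + x) = g (h + x).
    by move: fg; rewrite (near_shift 0) subr0.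
  apply: filterS2 fg0 (df e e0) => h fgh.
  by rewrite !fctE /= gx fgh.
apply/diff_locallyP; rewrite (diff_unique dfc gdf); split=> //.
Qed.

Lemma Ck_on_ext (R : realType) (V W : normedModType R) (k : nat) (U : set V)
    (f g : V -> W) : open U -> (forall x, U x -> f x = g x) ->
  Ck_on k U f -> Ck_on k U g.
Proof.
move=> oU; elim: k f g => [|k IHk] f g fg /=.
  move=> cf x Ux; rewrite /prop_for /continuous_at -(fg x Ux).
  apply: cvg_trans (cf x Ux); apply: near_eq_cvg.
  by apply: filterS (open_nbhs_nbhs (conj oU Ux)) => y /fg.
have near_fg x : U x -> \near x, f x = g x.
  by move=> Ux; apply: filterS (open_nbhs_nbhs (conj oU Ux)) => y /fg.
move=> [df Cf]; have dg x : U x -> differentiable g x.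
  by move=> Ux; apply: near_eq_differentiable (near_fg x Ux) (df x Ux).
split=> // v; apply: IHk (Cf v) => x Ux.
by rewrite -!deriveE ?(near_eq_derive _ (near_fg x Ux)) //; auto.
Qed.

Lemma smooth_on_linear (R : realType) (V W : normedModType R) (U : set V)
    (a : R) (f g : V -> W) : open U ->
  smooth_on U f -> smooth_on U g -> smooth_on U (a *: f + g).
Proof.
move=> oU Cf Cg k; move: {Cf Cg} (Cf k) (Cg k).
elim: k f g => [|k IHk] f g /=.
  move=> cf cg x Ux; apply: continuousD; last exact: cg.
  by apply: continuousZr; exact: cf.
move=> [df Cf] [dg Cg]; split=> [x Ux|v].
  by apply: differentiableD; [apply: differentiableZ|]; auto.
apply: Ck_on_ext (IHk _ _ (Cf v) (Cg v)) => // x Ux.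
rewrite diffD ?diffZ //; auto.
by apply: differentiableZ; auto.
Qed.

Section QuotientModule.
Variables (R : pzRingType) (V : lmodType R) (B : {pred V}).
Hypothesis B_submod : submod_closed B.

Definition zmod_pred : zmodClosed V :=
  HB.pack_for (zmodClosed V) (B : V -> bool)
    (GRing.isZmodClosed.Build V B (GRing.submod_closedB B_submod)).

(* The quotient module V / B. *)
Definition quot_lmod : Type := Quotient.quot zmod_pred.
HB.instance Definition _ := GRing.Zmodule.on quot_lmod.

Definition quot_pi (x : V) : quot_lmod := (\pi_(Quotient.quot zmod_pred) x)%qT.

Definition quot_scale (a : R) (x : quot_lmod) : quot_lmod :=
  quot_pi (a *: repr (x : Quotient.quot zmod_pred)).

Lemma quot_piP (x y : V) : quot_pi x = quot_pi y <-> x - y \in B.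
Proof.
rewrite -[x - y \in B]/(x - y \in zmod_pred) Quotient.idealrBE.
by split=> [H|/eqP]; [apply/eqP|].
Qed.

Lemma quot_ind (x : quot_lmod) : exists y, x = quot_pi y.
Proof. by exists (repr (x : Quotient.quot zmod_pred)); rewrite /quot_pi reprK. Qed.

Lemma quot_piD x y : quot_pi (x + y) = quot_pi x + quot_pi y.
Proof. by rewrite /quot_pi; exact: raddfD. Qed.

Lemma quot_piZ a x : quot_pi (a *: x) = quot_scale a (quot_pi x).
Proof.
apply/quot_piP; rewrite -scalerBr -[_ *: _]addr0; case: B_submod => B0 BL; apply: BL => //.
by apply/quot_piP; rewrite /quot_pi reprK.
Qed.

Lemma quot_scaleA a b v : quot_scale a (quot_scale b v) = quot_scale (a * b) v.
Proof. by have [y ->] := quot_ind v; rewrite -!quot_piZ scalerA. Qed.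

Lemma quot_scale1 : left_id 1 quot_scale.
Proof. by move=> v; have [y ->] := quot_ind v; rewrite -quot_piZ scale1r. Qed.

Lemma quot_scaleDr : right_distributive quot_scale +%R.
Proof.
move=> a v w; have [x ->] := quot_ind v; have [y ->] := quot_ind w.
by rewrite -quot_piD -!quot_piZ scalerDr quot_piD.
Qed.

Lemma quot_scaleDl v : {morph quot_scale^~ v : a b / a + b}.
Proof.
move=> a b; have [x ->] := quot_ind v.
by rewrite -!quot_piZ scalerDl quot_piD.
Qed.

HB.instance Definition _ := GRing.Zmodule_isLmodule.Build R quot_lmod
  quot_scaleA quot_scale1 quot_scaleDr quot_scaleDl.
End QuotientModule.

Lemma local_form_linear (R : realType) (M : manifold R) (k : nat)
    (c : chart R M (mdim M)) (a : R) (alpha beta : preform M k)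
    (v : 'I_k -> 'rV[R]_(mdim M)) :
  local_form c (a *: alpha + beta) v =
  a *: (local_form c alpha v : _ -> R^o) + local_form c beta v.
Proof. by []. Qed.

Lemma smooth_on_cst0 (R : realType) (V W : normedModType R) (U : set V) :
  smooth_on U (cst 0 : V -> W).
Proof.
elim=> [|k IHk] /=; first by move=> x _; exact: cst_continuous.
split=> [x _|v]; first exact: differentiable_cst.
rewrite (_ : (fun _ => _) = cst 0) //.
by apply/funext => x; rewrite diff_cst.
Qed.

Lemma is_form0 (R : realType) (M : manifold R) (k : nat) :
  is_form (0 : preform M k).
Proof.
split=> [p|c v _]; last exact: (@smooth_on_cst0 _ _ R^o).
by split=> // v i b x y; rewrite -[RHS]/(b * 0 + 0) mulr0 addr0.
Qed.

Lemma is_form_linear (R : realType) (M : manifold R) (k : nat) (a : R)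
    (alpha beta : preform M k) :
  is_form alpha -> is_form beta -> is_form (a *: alpha + beta).
Proof.
move=> [Aa Sa] [Ab Sb]; split=> [p|c v cA].
  have [La Za] := Aa p; have [Lb Zb] := Ab p.
  split=> [v i b x y|v i j ij vij].
    rewrite -![(_ *: alpha + beta) p _]/(a * alpha p _ + beta p _).
    by rewrite La Lb !mulrDr mulrCA addrACA.
  rewrite -![(_ *: alpha + beta) p _]/(a * alpha p _ + beta p _).
  by rewrite (Za _ _ _ ij vij) (Zb _ _ _ ij vij) mulr0 addr0.
rewrite local_form_linear.
by apply: smooth_on_linear; [exact: cod_open|exact: Sa|exact: Sb].
Qed.

Lemma local_form_differentiable (R : realType) (M : manifold R) (k : nat)
    (alpha : preform M k) (v : 'I_k -> 'rV[R]_(mdim M)) (p : M) :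
  is_form alpha ->
  differentiable (local_form (chart_at p) alpha v : _ -> R^o) (coord p).
Proof.
move=> [_ Sa]; have [d _] := Sa _ v (chart_at_atlas p) 1%N.
by apply: d; apply: fwd_cod; exact: chart_at_dom.
Qed.

Lemma dR_linear (R : realType) (M : manifold R) (k : nat) (a : R)
    (alpha beta : preform M k) : is_form alpha -> is_form beta ->
  dR (a *: alpha + beta) = a *: dR alpha + dR beta.
Proof.
move=> Fa Fb; apply/funext => p; apply/funext => v.
rewrite -[RHS]/(a * dR alpha p v + dR beta p v) /dR mulr_sumr -big_split /=.
apply: eq_bigr => i _; set w := fun j => v (lift i j).
have da := local_form_differentiable w p Fa.
have db := local_form_differentiable w p Fb.
rewrite local_form_linear diffD ?diffZ //; last exact: differentiableZ.
by rewrite /= [LHS]mulrDr; congr (_ + _); exact: mulrCA.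
Qed.

Lemma dR0 (R : realType) (M : manifold R) (k : nat) :
  dR (0 : preform M k) = 0.
Proof.
have := dR_linear 1 (is_form0 M k) (is_form0 M k).
by rewrite !scale1r addr0 => /esym/eqP; rewrite -subr_eq0 addrK => /eqP.
Qed.

Lemma basic0 (R : realType) (G : lie_groupoid R) (k : nat) :
  basic (0 : preform (objs G) k).
Proof. by split; [exact: is_form0|case: k => //= k X _|]. Qed.

Lemma basic_linear (R : realType) (G : lie_groupoid R) (k : nat) (a : R)
    (alpha beta : preform (objs G) k) :
  basic alpha -> basic beta -> basic (a *: alpha + beta).
Proof.
move=> [Fa Ha Ia] [Fb Hb Ib]; split; first exact: is_form_linear.
  case: k alpha beta {Fa Fb Ia Ib} Ha Hb => //= k alpha beta Ha Hb X sX.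
  rewrite -[LHS]/(a *: interior (fun p => anchor p (X p)) alpha +
                  interior (fun p => anchor p (X p)) beta).
  by rewrite (Ha X sX) (Hb X sX) scaler0 addr0.
move=> g v w vw; rewrite -[LHS]/(a * alpha (tgt g) w + beta (tgt g) w).
by rewrite (Ia _ _ _ vw) (Ib _ _ _ vw).
Qed.

(* Closed basic forms. *)
Definition cocycles (R : realType) (G : lie_groupoid R) (k : nat) :
    {pred preform (objs G) k} :=
  fun omega => `[< basic omega /\ dR omega = 0 >].

Lemma cocycles_submod (R : realType) (G : lie_groupoid R) (k : nat) :
  submod_closed (@cocycles R G k).
Proof.
split; first by apply/asboolP; split; [exact: basic0|exact: dR0].
move=> a alpha beta /asboolP[ba da] /asboolP[bb db]; apply/asboolP.
split; first exact: basic_linear.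
by rewrite dR_linear ?da ?db ?scaler0 ?addr0 //; [case: ba|case: bb].
Qed.

HB.instance Definition _ (R : realType) (G : lie_groupoid R) (k : nat) :=
  GRing.isSubmodClosed.Build R (preform (objs G) k) (@cocycles R G k)
    (cocycles_submod G k).

Definition cocycle (R : realType) (G : lie_groupoid R) (k : nat) : Type :=
  {omega : preform (objs G) k | omega \in @cocycles R G k}.

HB.instance Definition _ (R : realType) (G : lie_groupoid R) (k : nat) :=
  SubType.on (cocycle G k).
HB.instance Definition _ (R : realType) (G : lie_groupoid R) (k : nat) :=
  [Choice of cocycle G k by <:].
HB.instance Definition _ (R : realType) (G : lie_groupoid R) (k : nat) :=
  [SubChoice_isSubLmodule of cocycle G k by <:].

(* Differentials of basic forms. *)
Definition coboundaries (R : realType) (G : lie_groupoid R) (k : nat) :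
    {pred cocycle G k} :=
  match k return {pred cocycle G k} with
  | 0 => fun z => `[< \val z = 0 >]
  | k'.+1 => fun z => `[< exists2 beta : preform (objs G) k',
                           basic beta & \val z = dR beta >]
  end.

Lemma coboundaries_submod (R : realType) (G : lie_groupoid R) (k : nat) :
  submod_closed (@coboundaries R G k).
Proof.
case: k => [|k]; split.
- by apply/asboolP; rewrite raddf0.
- move=> a y z /asboolP y0 /asboolP z0; apply/asboolP.
  by rewrite linearP /= y0 z0 scaler0 addr0.
- by apply/asboolP; exists 0; [exact: basic0|rewrite dR0 raddf0].
- move=> a y z /asboolP[alpha ba ya] /asboolP[beta bb zb]; apply/asboolP.
  exists (a *: alpha + beta); first exact: basic_linear.
  by rewrite linearP /= ya zb dR_linear //; [case: ba|case: bb].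
Qed.

(* H^k_basic(G, R), a vector space over R. *)
Definition basic_cohomology (R : realType) (G : lie_groupoid R) (k : nat) :
    lmodType R := quot_lmod (coboundaries_submod G k).

Record lie_morphism (R : realType) (G H : lie_groupoid R) := LieMorphism {
  on_objs : objs G -> objs H;
  on_arrs : arrs G -> arrs H;
  on_objs_smooth : smooth_map on_objs;
  on_arrs_smooth : smooth_map on_arrs;
  src_morph : forall g, src (on_arrs g) = on_objs (src g);
  tgt_morph : forall g, tgt (on_arrs g) = on_objs (tgt g);
  unit_morph : forall p, on_arrs (unit_arr p) = unit_arr (on_objs p);
  mul_morph : forall g h, src g = tgt h ->
    on_arrs (mul g h) = mul (on_arrs g) (on_arrs h)
}.

Definition essentially_surjective (R : realType) (G H : lie_groupoid R)
    (f : lie_morphism G H) : Prop :=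
  exists (P : manifold R) (p1 : P -> arrs H) (p2 : P -> objs G),
    [/\ is_fiber_product (@src R H) (on_objs f) p1 p2,
        submersion (fun z => tgt (p1 z)) &
        forall q, exists z, tgt (p1 z) = q].

(* The fiber product property, in the category of smooth manifolds, of G_1 as
   H_1 x_{H_0 x H_0} (G_0 x G_0) via f and (src, tgt), where smooth maps into G_0 x G_0 and H_0 x H_0 are
   given by their two components. *)
Definition fully_faithful (R : realType) (G H : lie_groupoid R)
    (f : lie_morphism G H) : Prop :=
  forall (Q : manifold R) (a : Q -> arrs H) (x y : Q -> objs G),
    smooth_map a -> smooth_map x -> smooth_map y ->
    (forall z, src (a z) = on_objs f (x z)) ->
    (forall z, tgt (a z) = on_objs f (y z)) ->
    exists! h : Q -> arrs G,
      [/\ smooth_map h, forall z, on_arrs f (h z) = a z,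
          forall z, src (h z) = x z & forall z, tgt (h z) = y z].

Definition weak_equivalence (R : realType) (G H : lie_groupoid R)
    (f : lie_morphism G H) : Prop :=
  essentially_surjective f /\ fully_faithful f.

Definition morita_equivalent (R : realType) (G H : lie_groupoid R) : Prop :=
  exists (K : lie_groupoid R) (f : lie_morphism K G) (f' : lie_morphism K H),
    weak_equivalence f /\ weak_equivalence f'.

(* Main.v *)
Require Import Defs.
From HB Require Import structures.
From mathcomp Require Import all_boot all_order all_fingroup all_algebra.
From mathcomp Require Import all_classical all_reals all_analysis.
From mathcomp Require Import zify ring lra.

(** A weak equivalence f : K -> G induces an isomorphism between the complexes
    of basic forms, already before passing to cohomology; a Morita equivalence
    provides two of them with a common source.

    The starting point is that a form omega on the objects of a Lie groupoid is
    basic if and only if its pullbacks along the source and the target map agree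
    (basic_pullback, pullback_basic). Since pullback commutes with dR
    (dR_pullback), this makes the pullback of forms along f a morphism of
    complexes of basic forms.

    Let P be the fiber product of src : G_1 -> G_0 and f : K_0 -> G_0, with
    projections p1 and p2, and let e = tgt o p1 : P -> G_0, which is a
    surjective submersion by essential surjectivity. Call omega on G_0 and eta
    on K_0 related if their pullbacks along e and p2 agree on P. For basic
    omega, the pullback f^* omega is related to omega, as p1 z is an arrow from
    f (p2 z) to e z (related_pullback). Conversely, if omega is related to eta
    then eta = f^* omega (pullback_related), and if moreover omega is smooth it
    is basic (related_basic). As e is a surjective submersion, omega is
    determined by eta (related_inj), so f^* is injective on basic forms.

    For surjectivity a basic form eta on K_0 must descend (basic_descends).
    Along a local section sigma of e take the pullback of eta along p2 o sigma.
    Two points z, z' of P over the same object of G give an arrow from f (p2 z)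
    to f (p2 z'), which comes from an arrow of K from p2 z to p2 z' by full
    faithfulness. Done in smooth families, this and the invariance of eta show
    that the result is independent of the section and related to eta
    (section_pullback). The relation is compatible with dR, so closed and exact
    basic forms correspond as well, which gives the isomorphism in cohomology
    (weak_equivalence_cohomology).

    The analysis that this rests on is developed first: Schwarz's theorem
    (diff_diffC), on which d f^* = f^* d depends; the inverse function theorem
    (local_right_inverse), which provides local sections of submersions
    (local_section); and smooth maps from R^n into small open sets of a manifold
    (local_parametrization), on which the universal properties are tested. *)

Set Implicit Arguments.
Unset Strict Implicit.
Unset Printing Implicit Defensive.
Import Order.TTheory GRing.Theory Num.Theory.
Import numFieldNormedType.Exports.
(* restores the meaning of coord, a name also used in linear algebra *)
Import Defs.

Local Open Scope classical_set_scope.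
Local Open Scope ring_scope.

(** * C^k functions on open sets *)

Section CkCalculus.
Context {R : realType}.
Implicit Types V W : normedModType R.

Lemma Ck_on_sub V W k (U U' : set V) (f : V -> W) :
  U `<=` U' -> Ck_on k U' f -> Ck_on k U f.
Proof.
move=> UU'; elim: k f => [|k IH] f /=; first by move=> cf x /UU' /cf.
by move=> [df Cf]; split=> [x /UU' /df//|v]; exact: IH.
Qed.

Lemma Ck_onW V W k (U : set V) (f : V -> W) : Ck_on k.+1 U f -> Ck_on k U f.
Proof.
elim: k f => [|k IH] f [df Cf] /=.
  by move=> x /df; exact: differentiable_continuous.
by split=> // v; exact: IH.
Qed.

Lemma Ck_on_local V W k (U : set V) (f : V -> W) :
  (forall x, U x -> exists2 U' : set V, U' x & Ck_on k U' f) -> Ck_on k U f.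
Proof.
elim: k f => [|k IH] f /= H; first by move=> x /H[U' U'x /(_ x U'x)].
split=> [x /H[U' U'x [d _]]|v]; first exact: d.
by apply: IH => x /H[U' U'x [_ C]]; exists U'.
Qed.

Lemma Ck_onD V W k (U : set V) (f g : V -> W) : open U ->
  Ck_on k U f -> Ck_on k U g -> Ck_on k U (fun x => f x + g x).
Proof.
move=> oU; elim: k f g => [|k IH] f g /=.
  by move=> cf cg x Ux; apply: continuousD; [exact: cf|exact: cg].
move=> [df Cf] [dg Cg]; split=> [x Ux|v].
  by apply: differentiableD; [exact: df|exact: dg].
apply: Ck_on_ext (IH _ _ (Cf v) (Cg v)) => // x Ux.
exact: (congr1 (fun h => h v) (esym (diffD (df x Ux) (dg x Ux)))).
Qed.

Lemma Ck_on_cst V W k (U : set V) (a : W) : Ck_on k U (cst a).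
Proof.
elim: k a => [|k IH] a /=; first by move=> x _; exact: cst_continuous.
split=> [x _|v]; first exact: differentiable_cst.
rewrite (_ : (fun _ => _) = cst 0) //.
by apply/funext => x; rewrite diff_cst.
Qed.

Lemma Ck_on_sum V W k (U : set V) (I : Type) (r : seq I) (P : pred I)
    (f : I -> V -> W) : open U ->
  (forall i, P i -> Ck_on k U (f i)) ->
  Ck_on k U (fun x => \sum_(i <- r | P i) f i x).
Proof.
move=> oU Cf; elim: r => [|i r IH].
  rewrite (_ : (fun _ => _) = cst 0); first exact: Ck_on_cst.
  by apply/funext=> x; rewrite big_nil.
have [Pi|nPi] := boolP (P i); last first.
  by rewrite (_ : (fun _ => _) = fun x => \sum_(i <- r | P i) f i x) //;
    apply/funext=> x; rewrite big_cons (negbTE nPi).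
rewrite (_ : (fun _ => _) = fun x => f i x + \sum_(i <- r | P i) f i x).
  by apply: Ck_onD => //; exact: Cf.
by apply/funext=> x; rewrite big_cons Pi.
Qed.

Lemma Ck_on_linear V W k (U : set V) (f : {linear V -> W}) :
  continuous f -> Ck_on k U f.
Proof.
move=> cf; case: k => [|k] /=; first by move=> x _; exact: cf.
split=> [x _|v]; first exact: linear_differentiable.
rewrite (_ : (fun _ => _) = cst (f v)); first exact: Ck_on_cst.
by apply/funext => x; rewrite diff_lin.
Qed.


(** A named copy of scalar multiplication, to carry the structure of a bilinear
    map. *)
Let scaling W (a : R) (w : W) : W := a *: w.

Let scaling_bilinear W :
  bilinear_for
    (GRing.Scale.Law.clone _ _ *:%R _) (GRing.Scale.Law.clone _ _ *:%R _)
    (@scaling W).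
Proof.
rewrite /scaling; split=> [u'|u] a x y /=.
- by rewrite scalerDl scalerA.
- by rewrite scalerDr !scalerA mulrC.
Qed.
HB.instance Definition _ W := bilinear_isBilinear.Build R R W W _ _
  (@scaling W) (@scaling_bilinear W).

(** Scalar multiplication is a continuous bilinear map, hence differentiable. *)
Lemma differentiable_scale V W (a : V -> R) (g : V -> W) x :
  differentiable a x -> differentiable g x ->
  differentiable (fun y => a y *: g y) x.
Proof.
move=> da dg.
apply: (@differentiable_comp _ _ _ _ (fun y => (a y, g y))
  (fun p => scaling p.1 p.2)); first exact: differentiable_pair.
by apply: differentiable_bilin; exact: scale_continuous.
Qed.

Lemma diff_scale V W (a : V -> R) (g : V -> W) x v :
  differentiable a x -> differentiable g x ->
  'd (fun y => a y *: g y) x v = a x *: 'd g x v + 'd a x v *: g x.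
Proof.
move=> da dg.
rewrite (_ : (fun y => _) =
  (fun p => scaling p.1 p.2) \o (fun y => (a y, g y))) //.
rewrite diff_comp; last 2 first.
- exact: differentiable_pair.
- by apply: differentiable_bilin; exact: scale_continuous.
by rewrite /= diff_bilin ?diff_pair //; exact: scale_continuous.
Qed.

Lemma Ck_on_scale V W k (U : set V) (a : V -> R) (g : V -> W) : open U ->
  Ck_on k U (a : V -> R^o) -> Ck_on k U g -> Ck_on k U (fun x => a x *: g x).
Proof.
move=> oU; elim: k a g => [|k IH] a g.
  by move=> ca cg x Ux; apply: continuousZ; [exact: ca|exact: cg].
move=> Ca Cg; have [[da Ca'] [dg Cg']] := (Ca, Cg).
split=> [x Ux|v]; first exact: differentiable_scale (da x Ux) (dg x Ux).
apply: (@Ck_on_ext _ _ _ _ _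
  (fun x => a x *: 'd g x v + 'd a x v *: g x)) => //.
  move=> x Ux; exact: esym (diff_scale v (da x Ux) (dg x Ux)).
apply: Ck_onD => //; first exact: IH (Ck_onW Ca) (Cg' v).
exact: IH (Ca' v) (Ck_onW Cg).
Qed.

Lemma linear_rV_expand n (W : lmodType R) (f : {linear 'rV[R]_n -> W}) x :
  f x = \sum_i x ord0 i *: f (delta_mx ord0 i).
Proof.
rewrite {1}(row_sum_delta x) linear_sum.
by apply: eq_bigr => i _; rewrite linearZ.
Qed.

Lemma continuous_linear_rV n W (f : {linear 'rV[R]_n -> W}) : continuous f.
Proof.
rewrite (_ : (f : _ -> _) = fun x => \sum_i x ord0 i *: f (delta_mx ord0 i)).
  suff H : Ck_on 0 setT
      (fun x : 'rV[R]_n => \sum_i x ord0 i *: f (delta_mx ord0 i)).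
    by move=> x; exact: H.
  apply: Ck_on_sum => [|i _ x _]; first exact: openT.
  by apply: continuousZr_tmp; exact: coord_continuous.
by apply/funext => x; exact: linear_rV_expand.
Qed.

Lemma diff_coord V n (f : V -> 'rV[R]_n) x i v : differentiable f x ->
  differentiable (fun y => f y ord0 i) x /\
  'd (fun y => f y ord0 i) x v = 'd f x v ord0 i.
Proof.
move=> df; rewrite (_ : (fun y => f y ord0 i) =
  (fun y : 'rV[R]_n => y ord0 i) \o f) //.
have dc := differentiable_coord (f x) ord0 i.
split; first exact: differentiable_comp.
rewrite diff_comp //=.
pose c (y : 'rV[R]_n) := y ord0 i.
have lc : linear c by move=> a y z; rewrite /c !mxE.
pose cL : {linear 'rV[R]_n -> R} :=
  HB.pack c (GRing.isLinear.Build _ _ _ _ _ lc).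
rewrite -[fun _ => _]/(cL : _ -> _).
by rewrite diff_lin //; exact: coord_continuous.
Qed.

Lemma Ck_on_coord V n k (U : set V) (f : V -> 'rV[R]_n) i : open U ->
  Ck_on k U f -> Ck_on k U (fun x => f x ord0 i : R^o).
Proof.
move=> oU; elim: k f => [|k IH] f.
  move=> cf x Ux; apply: (@continuous_comp _ _ _ f (fun y : 'rV[R]_n => y ord0 i)).
    exact: cf.
  exact: coord_continuous.
move=> [df Cf]; split=> [x Ux|v]; first by have [] := diff_coord i 0 (df x Ux).
apply: (Ck_on_ext oU _ (IH _ (Cf v))) => x Ux.
by have [_ ->] := diff_coord i v (df x Ux).
Qed.

(** Basis vectors turn a map into a sum of products of scalar functions with
    constants. *)
Lemma Ck_on_row V n k (U : set V) (f : V -> 'rV[R]_n) : open U ->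
  (forall i, Ck_on k U (fun x => f x ord0 i : R^o)) -> Ck_on k U f.
Proof.
move=> oU Cf.
rewrite (_ : f = fun x => \sum_i f x ord0 i *: delta_mx ord0 i).
  by apply: Ck_on_sum => // i _; apply: Ck_on_scale => //; exact: Ck_on_cst.
by apply/funext => x; rewrite -row_sum_delta.
Qed.

Lemma open_preimage V W (U : set V) (U' : set W) (f : V -> W) :
  open U -> open U' -> (forall x, U x -> {for x, continuous f}) ->
  open (U `&` f @^-1` U').
Proof.
move=> oU oU' cf; rewrite openE => x [Ux U'fx].
apply: filterI; first exact: open_nbhs_nbhs.
by apply: cf => //; exact: open_nbhs_nbhs.
Qed.

(** By the chain rule the derivative of g o f along v is the sum over i of the
    i-th coordinate of 'd f x v times the i-th partial derivative of g at f x,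
    and the induction hypothesis applies to each partial derivative of g. *)
Lemma Ck_on_comp V n W k (U : set V) (U' : set 'rV[R]_n)
    (f : V -> 'rV[R]_n) (g : 'rV[R]_n -> W) : open U -> open U' ->
  Ck_on k U f -> Ck_on k U' g -> (forall x, U x -> U' (f x)) ->
  Ck_on k U (g \o f).
Proof.
move=> oU oU'; elim: k g => [|k IH] g Cf Cg fU.
  by move=> x Ux; apply: continuous_comp; [exact: Cf|apply: Cg; exact: fU].
have [[df Cdf] [dg Cdg]] := (Cf, Cg).
split=> [x Ux|v]; first exact: differentiable_comp (df x Ux) (dg _ (fU x Ux)).
apply: (@Ck_on_ext _ _ _ _ _ (fun x =>
  \sum_i 'd f x v ord0 i *: ((fun y => 'd g y (delta_mx ord0 i)) \o f) x)) => //.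
  move=> x Ux; rewrite (diff_comp (df x Ux) (dg _ (fU x Ux))).
  by rewrite -(linear_rV_expand ('d g (f x))).
apply: Ck_on_sum => // i _; apply: Ck_on_scale => //.
  by apply: Ck_on_coord => //; exact: Cdf.
exact: IH (Ck_onW Cf) (Cdg _) fU.
Qed.

Lemma Ck_onM V k (U : set V) (a b : V -> R) : open U ->
  Ck_on k U (a : V -> R^o) -> Ck_on k U (b : V -> R^o) ->
  Ck_on k U (fun x => a x * b x : R^o).
Proof. by move=> oU Ca Cb; exact: (@Ck_on_scale V R^o). Qed.

Lemma Ck_on_prod V k (U : set V) (I : Type) (r : seq I) (f : I -> V -> R) :
  open U -> (forall i, Ck_on k U (f i : V -> R^o)) ->
  Ck_on k U (fun x => \prod_(i <- r) f i x : R^o).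
Proof.
move=> oU Cf; elim: r => [|i r IH].
  rewrite (_ : (fun _ => _) = cst (1 : R^o)); first exact: Ck_on_cst.
  by apply/funext=> x; rewrite big_nil.
rewrite (_ : (fun _ => _) = fun x => f i x * \prod_(i <- r) f i x : R^o).
  exact: Ck_onM.
by apply/funext=> x; rewrite big_cons.
Qed.

Lemma Ck_onV V k (U : set V) (a : V -> R) : open U ->
  Ck_on k U (a : V -> R^o) -> (forall x, U x -> a x != 0) ->
  Ck_on k U (fun x => (a x)^-1 : R^o).
Proof.
move=> oU + a0; elim: k => [|k IH] Ca.
  by move=> x Ux; apply: continuousV; [exact: a0|exact: Ca].
have [da Cda] := Ca.
split=> [x Ux|v]; first exact: differentiableV (da x Ux) (a0 x Ux).
apply: (@Ck_on_ext _ _ _ _ _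
  (fun x => - 1 * ((a x)^-1 * (a x)^-1 * 'd a x v) : R^o)) => //.
  move=> x Ux; apply: etrans
    (esym (congr1 (fun h : V -> R => h v) (diffV (da x Ux) (a0 x Ux)))).
  by rewrite /= mulN1r -[_ *: _]/(_ * _) mulNr expr2 invfM.
have CV := IH (Ck_onW Ca).
exact: (@Ck_onM V k U (fun=> -1) _ oU (Ck_on_cst _ _ _)
  (Ck_onM oU (Ck_onM oU CV CV) (Cda v))).
Qed.

Lemma Ck_on_det V n k (U : set V) (M : V -> 'M[R]_n) : open U ->
  (forall i j, Ck_on k U (fun x => M x i j : R^o)) ->
  Ck_on k U (fun x => \det (M x) : R^o).
Proof.
move=> oU CM; apply: (@Ck_on_sum V R^o k U _ _ _ (fun (s : {perm 'I_n}) x =>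
  (-1) ^+ s * \prod_i M x i (s i))) => // s _.
apply: (@Ck_onM _ _ _ (fun=> (-1) ^+ s)) => //; first exact: Ck_on_cst.
by apply: Ck_on_prod => // i; exact: CM.
Qed.

(** Cramer's rule: the entries of the inverse are polynomials in the entries,
    divided by the determinant. *)
Lemma Ck_on_invmx V n k (U : set V) (M : V -> 'M[R]_n) : open U ->
  (forall i j, Ck_on k U (fun x => M x i j : R^o)) ->
  (forall x, U x -> M x \in unitmx) ->
  forall i j, Ck_on k U (fun x => invmx (M x) i j : R^o).
Proof.
move=> oU CM uM i j.
apply: (@Ck_on_ext _ _ _ _ _ (fun x => (\det (M x))^-1 *
    ((-1) ^+ (j + i) * \det (row' j (col' i (M x)))) : R^o)) => //.
  by move=> x Ux; rewrite /invmx uM // !mxE.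
apply: Ck_onM => //.
  apply: Ck_onV => //; first exact: Ck_on_det.
  by move=> x /uM; rewrite unitmxE unitfE.
apply: (@Ck_onM _ _ _ (fun=> (-1) ^+ (j + i))) => //; first exact: Ck_on_cst.
apply: Ck_on_det => // a b; apply: (Ck_on_ext oU _ (CM (lift j a) (lift i b))).
by move=> x Ux; rewrite !mxE.
Qed.

End CkCalculus.

(** * Smoothness at a point, symmetry of second derivatives *)

Section SmoothAt.
Context {R : realType}.
Implicit Types V W : normedModType R.

Lemma smooth_on_at V W (U : set V) (f : V -> W) x :
  open U -> smooth_on U f -> U x -> smooth_at f x.
Proof. by exists U; split. Qed.

(** Ck_on only imposes conditions at the single points of U. *)
Lemma smooth_at_on V W (U : set V) (f : V -> W) :
  (forall x, U x -> smooth_at f x) -> smooth_on U f.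
Proof.
by move=> sf k; apply: Ck_on_local => x /sf[U' [_ U'x Cf]]; exists U'.
Qed.

Lemma near_smooth_at V W (f : V -> W) x :
  smooth_at f x -> \forall y \near x, smooth_at f y.
Proof.
move=> [U [oU Ux sf]]; apply: filterS (open_nbhs_nbhs (conj oU Ux)) => y Uy.
by exists U.
Qed.

Lemma smooth_at_differentiable V W (f : V -> W) x :
  smooth_at f x -> differentiable f x.
Proof. by move=> [U [oU Ux /(_ 1%N)[df _]]]; exact: df. Qed.

Lemma smooth_at_continuous V W (f : V -> W) x :
  smooth_at f x -> {for x, continuous f}.
Proof. by move=> [U [oU Ux /(_ 0%N)cf]]; exact: cf. Qed.

Lemma smooth_at_diff V W (f : V -> W) x v :
  smooth_at f x -> smooth_at (fun y => 'd f y v) x.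
Proof.
by move=> [U [oU Ux sf]]; exists U; split=> // k; have [_] := sf k.+1; apply.
Qed.

Lemma smooth_at_ext V W (f g : V -> W) x :
  (\forall y \near x, f y = g y) -> smooth_at f x -> smooth_at g x.
Proof.
rewrite -nbhs_nearE nbhsE => -[U' [oU' U'x] fg] [U [oU Ux sf]].
have oI := openI oU oU'.
exists (U `&` U'); split=> // k; apply: (Ck_on_ext oI (f := f)).
  by move=> y [_ /fg].
exact: Ck_on_sub (sf k).
Qed.

Lemma smooth_at_cst V W (a : W) (x : V) : smooth_at (cst a) x.
Proof. by exists setT; split=> // [|k]; [exact: openT|exact: Ck_on_cst]. Qed.

Lemma smooth_at_linear V W (f : {linear V -> W}) x :
  continuous f -> smooth_at f x.
Proof.
by move=> cf; exists setT; split=> // [|k]; [exact: openT|exact: Ck_on_linear].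
Qed.

Lemma smooth_atD V W (f g : V -> W) x :
  smooth_at f x -> smooth_at g x -> smooth_at (fun y => f y + g y) x.
Proof.
move=> [U [oU Ux sf]] [U' [oU' U'x sg]]; have oI := openI oU oU'.
exists (U `&` U'); split=> // k; apply: Ck_onD => //.
  exact: Ck_on_sub (sf k).
exact: Ck_on_sub (sg k).
Qed.

Lemma smooth_at_scale V W (a : V -> R) (g : V -> W) x :
  smooth_at (a : V -> R^o) x -> smooth_at g x ->
  smooth_at (fun y => a y *: g y) x.
Proof.
move=> [U [oU Ux sf]] [U' [oU' U'x sg]]; have oI := openI oU oU'.
exists (U `&` U'); split=> // k; apply: Ck_on_scale => //.
  exact: Ck_on_sub (sf k).
exact: Ck_on_sub (sg k).
Qed.

Lemma smooth_at_sum V W (I : Type) (r : seq I) (f : I -> V -> W) x :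
  (forall i, smooth_at (f i) x) -> smooth_at (fun y => \sum_(i <- r) f i y) x.
Proof.
move=> sf; elim: r => [|i r IH].
  rewrite (_ : (fun _ => _) = cst 0); first exact: smooth_at_cst.
  by apply/funext=> y; rewrite big_nil.
rewrite (_ : (fun _ => _) = fun y => f i y + \sum_(j <- r) f j y).
  exact: smooth_atD.
by apply/funext=> y; rewrite big_cons.
Qed.

Lemma smooth_at_coord V n (f : V -> 'rV[R]_n) i x :
  smooth_at f x -> smooth_at (fun y => f y ord0 i : R^o) x.
Proof. by move=> [U [oU Ux sf]]; exists U; split=> // k; exact: Ck_on_coord. Qed.

Lemma smooth_atV V (a : V -> R) x :
  smooth_at (a : V -> R^o) x -> a x != 0 ->
  smooth_at (fun y => (a y)^-1 : R^o) x.
Proof.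
move=> [U [oU Ux sa]] ax0.
have oU' : open (U `&` a @^-1` [set r | r != 0]).
  have oN : open [set r : R^o | r != 0] by exact: open_neq.
  exact: (@open_preimage _ _ R^o) oU oN (sa 0%N).
exists (U `&` a @^-1` [set r | r != 0]); split=> // k.
by apply: Ck_onV => // [|y []//]; apply: Ck_on_sub (sa k) => y [].
Qed.

Lemma smooth_at_comp V n W (f : V -> 'rV[R]_n) (g : 'rV[R]_n -> W) x :
  smooth_at f x -> smooth_at g (f x) -> smooth_at (g \o f) x.
Proof.
move=> [U [oU Ux sf]] [U' [oU' U'fx sg]].
have oI : open (U `&` f @^-1` U') by apply: open_preimage => //; exact: (sf 0%N).
exists (U `&` f @^-1` U'); split=> // k.
apply: (Ck_on_comp oI oU' _ (sg k)) => [|y []//].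
exact: Ck_on_sub (sf k).
Qed.

Lemma smooth_at_id V (x : V) : smooth_at id x.
Proof. by apply: (@smooth_at_linear V V idfun) => y; exact: cvg_id. Qed.

Lemma near_eq_diff V W (f g : V -> W) x v : (\forall y \near x, f y = g y) ->
  differentiable f x -> 'd f x v = 'd g x v.
Proof.
move=> fg df; rewrite -!deriveE //; first exact: near_eq_derive.
exact: near_eq_differentiable df.
Qed.

Lemma diff_compE (V1 V W : normedModType R) (f : V1 -> V) (g : V -> W) x v :
  differentiable f x -> differentiable g (f x) ->
  'd (g \o f) x v = 'd g (f x) ('d f x v).
Proof. by move=> df dg; rewrite diff_comp. Qed.

Lemma is_diff_affine V W (a : W) (f : {linear V -> W}) x :
  continuous f -> is_diff x (fun y => a + f y) f.
Proof.
move=> cf; have df : differentiable f x by exact: linear_differentiable.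
have dc : differentiable (cst a : V -> W) x by exact: differentiable_cst.
apply: DiffDef; first exact: (differentiableD dc df).
apply: etrans (diffD dc df) _.
by rewrite diff_cst (diff_lin _ cf); apply/funext => v; exact: add0r.
Qed.

Lemma smooth_at_affine V W (a : W) (f : {linear V -> W}) x :
  continuous f -> smooth_at (fun y => a + f y) x.
Proof.
move=> cf; apply: (@smooth_atD _ _ (cst a)); first exact: smooth_at_cst.
exact: smooth_at_linear.
Qed.

Lemma is_diff_line W (a w : W) (s : R) :
  is_diff s (fun t : R => a + t *: w) ( *:%R^~ w).
Proof.
have lw : linear ( *:%R^~ w : R^o -> W).
  by move=> b t u; rewrite scalerDl scalerA.
pose L : {linear R^o -> W} := HB.pack ( *:%R^~ w : R^o -> W)
  (GRing.isLinear.Build _ _ _ _ _ lw).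
by apply: (@is_diff_affine R^o W a L s) => t; exact: scalel_continuous.
Qed.

(** The derivative of s |-> f (a + s w) is the directional derivative of f. *)
Lemma line_MVT V (f : V -> R) (a w : V) :
  (forall s : R, 0 <= s <= 1 -> differentiable f (a + s *: w)) ->
  exists2 s : R, 0 <= s <= 1 & f (a + w) - f a = 'd f (a + s *: w) w.
Proof.
move=> df; pose h (s : R) := f (a + s *: w).
have dh (s : R) : 0 <= s <= 1 ->
    is_diff s h (fun r => 'd f (a + s *: w) (r *: w)).
  move=> s01; have [dl El] := is_diff_line a w s.
  apply: DiffDef; first exact: differentiable_comp dl (df s s01).
  by apply: etrans (diff_comp dl (df s s01)) _; rewrite El.
have Dh (s : R) : s \in `]0, 1[ -> is_derive s 1 h ('d f (a + s *: w) w).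
  rewrite in_itv /= => /andP[/ltW s0 /ltW s1].
  have [d E] := dh s (introT andP (conj s0 s1)).
  apply: DeriveDef; first exact: diff_derivable.
  by rewrite (deriveE _ d) E scale1r.
have ch : {within `[0, 1], continuous h}.
  apply: derivable_within_continuous => s; rewrite in_itv /= => s01.
  by have [d _] := dh s s01; exact: diff_derivable.
have [s] := MVT_segment ler01 Dh ch.
rewrite in_itv /= => s01; rewrite /h scale1r scale0r addr0 subr0 mulr1 => E.
by exists s.
Qed.


Lemma differentiable_bound V W (g : V -> W) x (e : R) :
  differentiable g x -> 0 < e ->
  exists2 d : R, 0 < d & forall h, `|h| < d ->
    `|g (x + h) - g x - 'd g x h| <= e * `|h|.
Proof.
move=> /diff_locallyP[_ /eqaddoP dg] e0.
have /nbhs_norm0P[d d0 H] := dg e e0.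
exists d => // h /H /=; rewrite !fctE /= opprD addrA.
by rewrite (addrC h).
Qed.

Let second_difference V (f : V -> R) (x u v : V) (t : R) : R :=
  f (x + t *: u + t *: v) - f (x + t *: u) - f (x + t *: v) + f x.

Let second_differenceC V (f : V -> R) x u v t :
  second_difference f x u v t = second_difference f x v u t.
Proof.
by rewrite /second_difference (addrAC x) (addrAC _ (- f (x + t *: u))).
Qed.

(** The second difference is an increment along t u of the function
    F y = f (t v + y) - f y, so by the mean value theorem it is t times the
    increment along t v of the derivative of f in the direction u; the latter
    function is differentiable at x. *)
Let second_difference_bound V (f : V -> R) (x u v : V) (e : R) :
  (\forall y \near x, differentiable f y) ->
  differentiable (fun y => 'd f y u) x -> 0 < e ->
  exists2 d : R, 0 < d & forall t : R, 0 < t < d ->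
    `|second_difference f x u v t - t ^+ 2 * 'd (fun y => 'd f y u) x v|
      <= e * t ^+ 2.
Proof.
set g := fun y => 'd f y u => nf dg e0.
pose M := `|u| + `|v| + 1.
have M0 : 0 < M by rewrite ltr_wpDl // addr_ge0.
have [d1 d10 H1] : exists2 d : R, 0 < d &
    forall h, `|h| < d -> differentiable f (x + h).
  have /nbhs_norm0P[d d0 H] : \forall h \near 0, differentiable f (h + x).
    by move: nf; rewrite (near_shift 0) subr0.
  by exists d => // h /H; rewrite addrC.
have e'0 : 0 < e / (2 * M) by rewrite divr_gt0 // mulr_gt0.
have [d2 d20 H2] := differentiable_bound dg e'0.
exists (Num.min d1 d2 / M); first by rewrite divr_gt0 // lt_min d10.
move=> t /andP[t0]; rewrite ltr_pdivlMr // lt_min => /andP[td1 td2].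
(* both points x + s t u and x + s t u + t v lie within t M of x *)
have small (s b : R) : 0 <= s <= 1 -> 0 <= b <= 1 ->
    `|s *: (t *: u) + b *: (t *: v)| <= t * M.
  move=> /andP[s0 s1] /andP[b0 b1]; apply: le_trans (ler_normD _ _) _.
  rewrite !normrZ (ger0_norm s0) (ger0_norm b0) (gtr0_norm t0).
  have tu : 0 <= t * `|u| by rewrite mulr_ge0 // ltW.
  have tv : 0 <= t * `|v| by rewrite mulr_ge0 // ltW.
  apply: le_trans (lerD (ler_piMl tu s1) (ler_piMl tv b1)) _.
  by rewrite -!mulrDr ler_pM2l // lerDl.
have i0 : 0 <= (0 : R) <= 1 by rewrite lexx ler01.
have i1 : 0 <= (1 : R) <= 1 by rewrite lexx ler01.
have small0 (s : R) (s01 : 0 <= s <= 1) : `|s *: (t *: u)| <= t * M.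
  by have := small s 0 s01 i0; rewrite scale0r addr0.
have small1 (s : R) (s01 : 0 <= s <= 1) : `|s *: (t *: u) + t *: v| <= t * M.
  by have := small s 1 s01 i1; rewrite scale1r.
have dfx (s : R) (s01 : 0 <= s <= 1) : differentiable f (x + s *: (t *: u)).
  exact: H1 (le_lt_trans (small0 s s01) td1).
have dfxv (s : R) (s01 : 0 <= s <= 1) :
    differentiable f (t *: v + (x + s *: (t *: u))).
  by rewrite addrC -addrA; exact: H1 (le_lt_trans (small1 s s01) td1).
pose F y := f (t *: v + y) - f y.
have dF (s : R) : 0 <= s <= 1 -> is_diff (x + s *: (t *: u)) F
    ('d f (t *: v + (x + s *: (t *: u))) \- 'd f (x + s *: (t *: u))).
  move=> s01; set y := x + _.
  have [dS ES] := @is_diff_affine V V (t *: v) idfun y (fun z => cvg_id).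
  have dfS := differentiable_comp dS (dfxv s s01).
  apply: DiffDef; first exact: differentiableB dfS (dfx s s01).
  apply: etrans (diffB dfS (dfx s s01)) _; apply/funext => w.
  congr (_ - _); apply: etrans (diff_compE w dS (dfxv s s01)) _.
  by congr ('d f _ _); rewrite ES.
have [s s01] : exists2 s : R, 0 <= s <= 1 &
    F (x + t *: u) - F x = 'd F (x + s *: (t *: u)) (t *: u).
  by apply: line_MVT => s /dF[].
have [_ EdF] := dF s s01.
have Eg y : 'd f y (t *: u) = t * g y by exact: linearZ.
rewrite EdF /= !Eg -mulrBr => EF.
have -> : second_difference f x u v t = F (x + t *: u) - F x.
  rewrite /second_difference /F (addrC (t *: v)) (addrC (t *: v)); ring.
rewrite EF (addrC (t *: v)) -addrA.
have B1 := H2 _ (le_lt_trans (small0 s s01) td2).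
have B2 := H2 _ (le_lt_trans (small1 s s01) td2).
have := small0 s s01; have := small1 s s01.
set h1 := s *: (t *: u) in B1 B2 *.
rewrite (_ : 'd g x (h1 + _) = 'd g x h1 + t * 'd g x v) in B2; last first.
  by rewrite linearD; congr (_ + _); exact: linearZ.
move: B1 B2; set G1 := g (x + h1); set G2 := g (x + (h1 + t *: v)).
set A1 := 'd g x h1; set A2 := 'd g x v; set e1 := e / _.
set n1 := `|h1|; set n2 := `|h1 + _|.
move=> B1 B2 N1 N2.
have Ee : e1 * (2 * M) = e by rewrite /e1 divfK // mulf_neq0 // gt_eqF.
rewrite (_ : _ - _ = t * ((G2 - g x - (A1 + t * A2)) - (G1 - g x - A1)));
  last by ring.
rewrite normrM (gtr0_norm t0) -Ee expr2 (mulrC _ (t * t)) -mulrA ler_pM2l //.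
apply: le_trans (ler_normB _ _) _.
apply: le_trans (lerD B2 B1) _.
have -> : t * (e1 * (2 * M)) = e1 * (t * M) + e1 * (t * M) by ring.
by apply: lerD; rewrite ler_pM2l.
Qed.

(** Schwarz's theorem: the second difference is symmetric in u and v, and up to
    o(t ^+ 2) it is t ^+ 2 times either of the two mixed derivatives. *)
Lemma diff_diffC V (f : V -> R) (x u v : V) :
  (\forall y \near x, differentiable f y) ->
  differentiable (fun y => 'd f y u) x ->
  differentiable (fun y => 'd f y v) x ->
  'd (fun y => 'd f y u) x v = 'd (fun y => 'd f y v) x u.
Proof.
move=> nf du dv; apply/eqP; rewrite -subr_eq0 -normr_eq0 eq_le normr_ge0 andbT.
apply/ler_addgt0Pl => e e0; rewrite addr0.
have e20 : 0 < e / 2 by rewrite divr_gt0.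
have [d1 d10 H1] := second_difference_bound v nf du e20.
have [d2 d20 H2] := second_difference_bound u nf dv e20.
pose t := Num.min d1 d2 / 2.
have m0 : 0 < Num.min d1 d2 by rewrite lt_min d10.
have t0 : 0 < t by rewrite divr_gt0.
have tm : t < Num.min d1 d2 by rewrite ltr_pdivrMr // mulr_natr mulr2n ltrDl.
move: tm; rewrite lt_min => /andP[td1 td2].
have B1 := H1 t (introT andP (conj t0 td1)).
have := H2 t (introT andP (conj t0 td2)); rewrite second_differenceC => B2.
have t20 : 0 < t ^+ 2 by rewrite exprn_gt0.
rewrite -(ler_pM2l t20) -{1}(gtr0_norm t20) -normrM mulrBr.
move: B1 B2; set S := second_difference _ _ _ _ _.
set a := t ^+ 2 * _; set b := t ^+ 2 * _ => B1 B2.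
rewrite (_ : a - b = (S - b) - (S - a)); last by ring.
apply: le_trans (ler_normB _ _) _; apply: le_trans (lerD B2 B1) _.
by rewrite -mulrDl -splitr mulrC.
Qed.

End SmoothAt.

(** * The inverse function theorem *)

Section InverseFunction.
Context {R : realType}.

Lemma rV_norm_coord n (v : 'rV[R]_n) i : `|v ord0 i| <= `|v|.
Proof.
rewrite [leRHS]/Num.norm /= mx_normrE.
exact: (@le_bigmax _ _ _ 0 (fun ij : 'I_1 * 'I_n => `|v ij.1 ij.2|) (ord0, i)).
Qed.

Lemma rV_norm_le n (v : 'rV[R]_n) (c : R) : 0 <= c ->
  (forall i, `|v ord0 i| <= c) -> `|v| <= c.
Proof.
move=> c0 vc; rewrite [leLHS]/Num.norm /= mx_normrE.
by apply/bigmax_leP; split=> // -[a i] _ /=; rewrite ord1.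
Qed.

Variables (n : nat) (phi : 'rV[R]_n -> 'rV[R]_n) (x0 : 'rV[R]_n).
Variable U : set 'rV[R]_n.
Hypotheses (oU : open U) (Ux0 : U x0) (sphi : smooth_on U phi).
Hypothesis dphi0 : forall v, 'd phi x0 v = v.

Let dphi x : U x -> differentiable phi x.
Proof. by move=> Ux; have [df _] := sphi 1; exact: df. Qed.

(** Continuity of the partial derivatives at x0 gives the bound on each basis
    vector; n of these are added up, which explains the constant c in the
    proof. *)
Let near_identity : exists2 r : R, 0 < r & forall x, `|x - x0| <= r ->
  U x /\ forall v, `|'d phi x v - v| <= 2^-1 * `|v|.
Proof.
pose c : R := (2 * n.+1%:R)^-1.
have c0 : 0 < c by rewrite invr_gt0 mulr_gt0.
have near_c : \forall x \near x0, forall i : 'I_n,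
    `|'d phi x (delta_mx ord0 i) - delta_mx ord0 i| <= c.
  apply: (filter_forall (nbhs_filter x0)) => i.
  have [_ /(_ (delta_mx ord0 i))/(_ _ Ux0)] := sphi 1.
  move=> /cvgrPdist_le/(_ c c0); apply: filterS => x H.
  rewrite distrC.
  exact: (eq_ind _ (fun w => `|w - 'd phi x _| <= c) H _ (dphi0 _)).
have [r /= r0 H] := iffLR (nbhs_ballP x0 _)
  (filterI (open_nbhs_nbhs (conj oU Ux0)) near_c).
 exists (r / 2); first by rewrite divr_gt0.
move=> x xr; have /H[Ux Hx] : ball x0 r x.
  rewrite -ball_normE /= distrC (le_lt_trans xr) // ltr_pdivrMr //.
  by rewrite mulr_natr mulr2n ltrDl.
split=> // v.
have -> : 'd phi x v - v =
    \sum_i v ord0 i *: ('d phi x (delta_mx ord0 i) - delta_mx ord0 i).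
  rewrite (linear_rV_expand ('d phi x)) {2}(row_sum_delta v) -sumrB.
  by apply: eq_bigr => i _; rewrite scalerBr.
apply: le_trans (ler_norm_sum _ _ _) _.
apply: (@le_trans _ _ (\sum_(i < n) `|v| * c)).
  by apply: ler_sum => i _; rewrite normrZ ler_pM // rV_norm_coord.
rewrite sumr_const card_ord -[leLHS]mulr_natr -mulrA mulrC ler_wpM2r //.
rewrite /c invfM -mulrA ger_pMr // mulrC ler_pdivrMr // mul1r ler_nat.
exact: leqnSn.
Qed.

Let r : R := s2val (cid2 near_identity).
Let r0 : 0 < r. Proof. exact: s2valP (cid2 near_identity). Qed.
Let B := [set x : 'rV[R]_n | `|x0 - x| <= r].

Let BU x : B x -> U x.
Proof. by rewrite /B /= distrC => /(s2valP' (cid2 near_identity))[]. Qed.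

Let dphi_near x v : B x -> `|'d phi x v - v| <= 2^-1 * `|v|.
Proof. by rewrite /B /= distrC => /(s2valP' (cid2 near_identity))[]. Qed.

Let B_convex x y (s : R) : B x -> B y -> 0 <= s <= 1 -> B (y + s *: (x - y)).
Proof.
rewrite /B /= => Bx By /andP[s0 s1].
have -> : x0 - (y + s *: (x - y)) = (1 - s) *: (x0 - y) + s *: (x0 - x).
  by apply/rowP => i; rewrite !mxE; ring.
apply: le_trans (ler_normD _ _) _; rewrite !normrZ (ger0_norm s0).
rewrite ger0_norm ?subr_ge0 //.
have : (1 - s) * `|x0 - y| <= (1 - s) * r by rewrite ler_wpM2l ?subr_ge0.
have : s * `|x0 - x| <= s * r by rewrite ler_wpM2l.
by nra.
Qed.

(** phi - id is a contraction on B by the mean value inequality, taken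
    coordinate by coordinate in the maximum norm. *)
Let contracting x y : B x -> B y ->
  `|(phi x - x) - (phi y - y)| <= 2^-1 * `|x - y|.
Proof.
move=> Bx By; apply: rV_norm_le => [|i]; first by rewrite mulr_ge0.
pose f z := phi z - z.
pose g z := f z ord0 i.
have dfz z : B z -> differentiable f z /\ forall v, 'd f z v = 'd phi z v - v.
  move=> /BU/dphi dz; have [did Eid] : is_diff z id id by exact: is_diff_id.
  split=> [|v]; first exact: (differentiableB dz did).
  apply: etrans (congr1 (fun h : _ -> _ => h v) (diffB dz did)) _.
  by congr (_ - _); exact: (congr1 (fun h : _ -> _ => h v) Eid).
have [s s01] : exists2 s : R, 0 <= s <= 1 &
    g (y + (x - y)) - g y = 'd g (y + s *: (x - y)) (x - y).
  apply: line_MVT => s s01; have [d _] := dfz _ (B_convex Bx By s01).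
  by have [] := diff_coord i 0 d.
have Bs := B_convex Bx By s01; have [d Ed] := dfz _ Bs.
have [_ ->] := diff_coord i (x - y) d.
rewrite subrKC => E.
have -> : (phi x - x - (phi y - y)) ord0 i = g x - g y by rewrite /g /f !mxE.
by rewrite E Ed; apply: le_trans (rV_norm_coord _ _) (dphi_near _ Bs).
Qed.

(** A perturbation of the identity by a contraction of ratio 1/2 shrinks
    distances at most by a factor 2. *)
Let expanding x y : B x -> B y -> `|x - y| <= 2 * `|phi x - phi y|.
Proof.
move=> Bx By; have := contracting Bx By.
have : `|x - y| <= `|phi x - phi y| + `|(phi x - x) - (phi y - y)|.
  rewrite -[`|_ - (phi y - y)|]normrN; apply: le_trans (ler_normD _ _).
  rewrite (_ : _ - _ - _ = x - y) //.
  by apply/rowP => i; rewrite !mxE; ring.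
by lra.
Qed.

(** The map T x = x - (phi x - y) preserves the compact ball B. At a point c of
    B where |phi c - y| is minimal, |phi (T c) - y| is at most half of it, so
    the minimum is 0. *)
Let onto_ball y : `|y - phi x0| <= r / 2 -> exists2 x, B x & phi x = y.
Proof.
move=> yr; pose T x := x - (phi x - y).
have Bx0 : B x0 by rewrite /B /= subrr normr0 ltW.
have TB x : B x -> B (T x).
  move=> Bx.
  have := contracting Bx Bx0; move: (Bx); rewrite /B /= /T => xr.
  have -> : x0 - (x - (phi x - y)) =
      (phi x - x - (phi x0 - x0)) - (y - phi x0).
    by apply/rowP => i; rewrite !mxE; ring.
  move=> C; apply: le_trans (ler_normB _ _) _.
  by move: C; rewrite (distrC x); lra.
have cB : compact B.
  apply: bounded_closed_compact; last exact: (@closed_closed_ball_ _ _ x0 r).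
  exists (r + `|x0|); split; first by rewrite num_real.
  move=> M rM x; rewrite /B /= => xr; apply: le_trans (ltW rM).
  rewrite -[leLHS](congr1 Num.norm (subrK x0 x)).
  by apply: le_trans (ler_normD _ _) _; rewrite lerD2r distrC.
have cg : {within B, continuous (fun x => `|phi x - y|)}.
  apply: continuous_in_subspaceT => x; rewrite inE => /BU/dphi dx.
  apply: (@continuous_comp _ _ _ (fun x => phi x - y));
    last exact: norm_continuous.
  apply: continuousB; last exact: cst_continuous.
  exact: differentiable_continuous.
have [c] := EVT_min_rV (ex_intro B x0 Bx0) cB cg.
rewrite inE => Bc minc; exists c => //.
have := minc (T c); rewrite inE => /(_ (TB c Bc)).
have -> : phi (T c) - y = (phi (T c) - T c) - (phi c - c).
  by apply/rowP => i; rewrite !mxE; ring.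
move=> /le_trans/(_ (contracting (TB c Bc) Bc)).
have -> : T c - c = - (phi c - y) by rewrite /T addrAC subrr add0r.
rewrite normrN => h; apply/eqP; rewrite -subr_eq0 -normr_eq0.
by rewrite eq_le normr_ge0 andbT; lra.
Qed.

Let V := ball (phi x0) (r / 2).

Let inv_spec y : exists x, V y -> B x /\ phi x = y.
Proof.
have [Vy|nVy] := pselect (V y); last by exists x0.
have [|x Bx px] := @onto_ball y; last by exists x.
by move: Vy; rewrite /V -ball_normE /= distrC => /ltW.
Qed.

Let psi y := projT1 (cid (inv_spec y)).

Let psiB y : V y -> B (psi y).
Proof. by move=> /(projT2 (cid (inv_spec y)))[]. Qed.

Let psiK y : V y -> phi (psi y) = y.
Proof. by move=> /(projT2 (cid (inv_spec y)))[]. Qed.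

Let oV : open V. Proof. exact: ball_open. Qed.

Let psi_lipschitz y z : V y -> V z -> `|psi y - psi z| <= 2 * `|y - z|.
Proof.
move=> Vy Vz; rewrite -{2}(psiK Vy) -{2}(psiK Vz).
exact: expanding (psiB Vy) (psiB Vz).
Qed.

Let J x := 'J phi x.

Let dphiE x v : 'd phi x v = v *m J x.
Proof. exact: esym (mul_rV_lin1 ('d phi x) v). Qed.

Let J_unit x : B x -> J x \in unitmx.
Proof.
move=> Bx; rewrite -row_free_unit; apply: inj_row_free => v vJ.
have := dphi_near v Bx; rewrite dphiE vJ sub0r normrN => h.
by apply/eqP; rewrite -normr_eq0 eq_le normr_ge0 andbT; lra.
Qed.

(** Put k = psi (y + h) - psi y. Then h is 'd phi applied to k up to o(k), and
    |k| <= 2 |h| because phi expands, so k is the inverse of 'd phi applied to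
    h up to o(h). *)
Let psi_diff y : V y -> is_diff y psi (fun v => v *m invmx (J (psi y))).
Proof.
move=> Vy; set x := psi y.
have Bx : B x by exact: psiB.
pose L := mulmxr (invmx (J x)) : {linear 'rV[R]_n -> 'rV[R]_n}.
have cL : continuous L by exact: continuous_linear_rV.
have [C C0 LC] := linear_lipschitz cL.
have H : psi \o shift y = cst (psi y) + L +o_ (0 : 'rV[R]_n) id.
  apply/eqaddoP => e e0.
  have e'0 : 0 < e / (C * 2) by rewrite divr_gt0 // mulr_gt0.
  have [d d0 Hd] := differentiable_bound (dphi (BU Bx)) e'0.
  have nV : \forall h \near (0 : 'rV[R]_n), V (h + y).
    have := open_nbhs_nbhs (conj oV Vy).
    by rewrite nbhs_nearE (near_shift 0) subr0.
  have nd : \forall h \near (0 : 'rV[R]_n), `|h| < d / 2.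
    by apply/nbhs_norm0P; exists (d / 2) => //=; rewrite divr_gt0.
  apply: filterS2 nV nd => h Vh hd; rewrite !fctE /=.
  set k := psi (h + y) - x.
  have kh : `|k| <= 2 * `|h|.
    by have := psi_lipschitz Vh Vy; rewrite -addrA subrr addr0.
  have kd : `|k| < d by apply: le_lt_trans kh _; rewrite mulrC -ltr_pdivlMr.
  have := Hd k kd; rewrite {1}/k subrKC psiK // (psiK Vy) addrK => Hk.
  have -> : psi (h + y) - (psi y + h *m invmx (J x)) = - L (h - 'd phi x k).
    rewrite opprD addrA -/x -/k linearB /= dphiE mulmxK ?J_unit //.
    by rewrite opprB.
  rewrite normrN; apply: le_trans (LC _) _.
  apply: le_trans (ler_wpM2l (ltW C0) Hk) _.
  rewrite mulrA mulrC; apply: le_trans (ler_wpM2r _ kh) _.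
    by rewrite mulr_ge0 // ltW.
  rewrite le_eqVlt; apply/orP; left; apply/eqP.
  have Cn : C != 0 by rewrite gt_eqF.
  by field.
have Ed := diff_unique cL H.
apply: DiffDef; last exact: Ed.
by apply/diff_locallyP; rewrite Ed.
Qed.

(** Bootstrapping: the differential of psi is the inverse of the Jacobian matrix
    of phi evaluated along psi, hence as regular as psi itself. *)
Let psi_Ck k : Ck_on k V psi.
Proof.
elim: k => [|k IH].
  by move=> y /psi_diff[dy _]; exact: differentiable_continuous.
have CJ i j : Ck_on k V (fun y => J (psi y) i j : R^o).
  have Cd : Ck_on k V ((fun x => 'd phi x (delta_mx ord0 i)) \o psi).
    apply: (Ck_on_comp oV oU IH) => [|y /psiB/BU//].
    by have [_] := sphi k.+1; apply.
  apply: (Ck_on_ext oV _ (Ck_on_coord j oV Cd)) => y _.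
  by rewrite /J /jacobian /lin1_mx [RHS]mxE.
have uJ y : V y -> J (psi y) \in unitmx by move=> /psiB/J_unit.
have Cinv i j := Ck_on_invmx oV CJ uJ i j.
split=> [y /psi_diff[]//|v].
have Cv : Ck_on k V (fun y => v *m invmx (J (psi y))).
  apply: Ck_on_row => // j.
  have Cs : Ck_on k V (fun y => \sum_i v ord0 i * invmx (J (psi y)) i j : R^o).
    apply: (@Ck_on_sum _ _ R^o) => // i _.
    by apply: Ck_onM => //; exact: Ck_on_cst.
  by apply: (Ck_on_ext oV _ Cs) => y _; rewrite [RHS]mxE.
apply: (Ck_on_ext oV _ Cv) => y /psi_diff[_ E].
exact: (congr1 (fun h : _ -> _ => h v) (esym E)).
Qed.

(** The inverse function theorem, normalised by 'd phi x0 = id; only the right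
    inverse is recorded, as it is what produces sections of submersions. *)
Theorem local_right_inverse :
  exists (V' : set 'rV[R]_n) (psi' : 'rV[R]_n -> 'rV[R]_n),
  [/\ open V', V' (phi x0), smooth_on V' psi', psi' (phi x0) = x0 &
      forall y, V' y -> U (psi' y) /\ phi (psi' y) = y].
Proof.
have Vx0 : V (phi x0) by apply: ballxx; rewrite divr_gt0.
have Bx0 : B x0 by rewrite /B /= subrr normr0 ltW.
exists V, psi; split; [exact: oV|exact: Vx0|exact: psi_Ck| |].
  apply/eqP; rewrite -subr_eq0 -normr_eq0 eq_le normr_ge0 andbT.
  have := expanding (psiB Vx0) Bx0; rewrite psiK // subrr normr0 mulr0.
  exact.
by move=> y Vy; split; [exact: BU (psiB Vy)|exact: psiK].
Qed.

End InverseFunction.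

(** * Smooth maps in charts *)

Section Charts.
Context {R : realType}.
Implicit Types M N P : manifold R.

Lemma near_open (T : topologicalType) (A : set T) (x : T) :
  open A -> A x -> nbhs x A.
Proof. by move=> oA Ax; exact: open_nbhs_nbhs. Qed.

(** The condition of smooth_map at one point. Local sections of submersions are
    total functions that satisfy it only on an open set. *)
Definition smooth_map_at M N (f : M -> N) (p : M) : Prop :=
  {for p, continuous f} /\ smooth_at (local_map f p) (coord p).

Lemma near_dom M (c : chart R M (mdim M)) p :
  dom c p -> \forall q \near p, dom c q.
Proof. by move=> cp; apply: open_nbhs_nbhs; split; [exact: dom_open|]. Qed.

Lemma near_chart M (c : chart R M (mdim M)) p (A : set M) : dom c p ->
  (\forall q \near p, A q) -> \forall x \near fwd c p, cod c x /\ A (bwd c x).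
Proof.
move=> cp nA; have cx := fwd_cod cp.
have := bwd_continuous cx.
rewrite /prop_for /continuous_at fwdK // => /(_ _ nA) nB.
have nC := near_open (@cod_open _ _ _ c) cx.
exact: (filterI nC nB).
Qed.

Lemma transition_smooth M (c c' : chart R M (mdim M)) p :
  atlas c -> atlas c' -> dom c p -> dom c' p ->
  smooth_at (fwd c' \o bwd c) (fwd c p).
Proof.
move=> ac ac' cp c'p; apply: smooth_on_at (atlas_smooth ac ac') _.
  rewrite openE => x [cx c'x].
  have nC := near_open (@cod_open _ _ _ c) cx.
  have nD := bwd_continuous cx (near_open (@dom_open _ _ _ c') c'x).
  exact: (filterI nC nD).
by split; [exact: fwd_cod|rewrite /preimage /= fwdK].
Qed.

Let in_charts M N (f : M -> N) (c : chart R M (mdim M))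
  (c' : chart R N (mdim N)) := fwd c' \o f \o bwd c.

Lemma change_charts M N (f : M -> N) p (c1 c2 : chart R M (mdim M))
    (d1 d2 : chart R N (mdim N)) :
  dom c1 p -> dom c2 p -> dom d1 (f p) -> {for p, continuous f} ->
  \forall x \near fwd c2 p, (fwd d2 \o bwd d1)
    (in_charts f c1 d1 ((fwd c1 \o bwd c2) x)) = in_charts f c2 d2 x.
Proof.
move=> c1p c2p d1p cf.
have nd : \forall q \near p, dom d1 (f q) := cf _ (near_dom d1p).
have nA : \forall q \near p, dom c1 q /\ dom d1 (f q).
  exact: (filterI (near_dom c1p) nd).
apply: filterS (near_chart c2p nA) => x [_ [c1x d1x]].
by rewrite /in_charts /= fwdK // fwdK.
Qed.

(** The two local expressions differ by transition maps, which are smooth, so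
    that any two charts may be used to test smoothness at p. *)
Lemma change_charts_smooth M N (f : M -> N) p (c1 c2 : chart R M (mdim M))
    (d1 d2 : chart R N (mdim N)) : atlas c1 -> atlas c2 -> atlas d1 -> atlas d2 ->
  dom c1 p -> dom c2 p -> dom d1 (f p) -> dom d2 (f p) ->
  {for p, continuous f} -> smooth_at (fwd d1 \o f \o bwd c1) (fwd c1 p) ->
  smooth_at (fwd d2 \o f \o bwd c2) (fwd c2 p).
Proof.
move=> ac1 ac2 ad1 ad2 c1p c2p d1p d2p cf sf.
apply: smooth_at_ext (change_charts d2 c1p c2p d1p cf) _.
have s1 := transition_smooth ac2 ac1 c2p c1p.
have s2 : smooth_at (in_charts f c1 d1 \o (fwd c1 \o bwd c2)) (fwd c2 p).
  by apply: smooth_at_comp s1 _; rewrite /= fwdK.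
apply: (smooth_at_comp s2); rewrite /in_charts /= !fwdK //.
exact: transition_smooth.
Qed.

Lemma smooth_map_at_charts M N (f : M -> N) p c c' :
  smooth_map_at f p -> atlas c -> atlas c' -> dom c p -> dom c' (f p) ->
  smooth_at (fwd c' \o f \o bwd c) (fwd c p).
Proof.
move=> [cf sf] ac ac' cp c'p.
exact: (change_charts_smooth (chart_at_atlas p) ac (chart_at_atlas (f p)) ac'
  (chart_at_dom p) cp (chart_at_dom (f p)) c'p cf sf).
Qed.

Lemma charts_smooth_map_at M N (f : M -> N) p c c' :
  {for p, continuous f} -> atlas c -> atlas c' -> dom c p -> dom c' (f p) ->
  smooth_at (fwd c' \o f \o bwd c) (fwd c p) -> smooth_map_at f p.
Proof.
move=> cf ac ac' cp c'p sf; split=> //.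
exact: (change_charts_smooth ac (chart_at_atlas p) ac' (chart_at_atlas (f p))
  cp (chart_at_dom p) c'p (chart_at_dom (f p)) cf sf).
Qed.

Lemma near_local_map_comp M N P (f : M -> N) (g : N -> P) p :
  {for p, continuous f} ->
  \forall x \near coord p, (local_map g (f p) \o local_map f p) x =
    local_map (g \o f) p x.
Proof.
move=> cf; have nd : \forall q \near p, dom (chart_at (f p)) (f q).
  exact: (cf _ (near_dom (chart_at_dom (f p)))).
apply: filterS (near_chart (chart_at_dom p) nd) => x [_ dx].
by rewrite /local_map /= fwdK.
Qed.

Lemma local_map_coord M N (f : M -> N) p : local_map f p (coord p) = coord (f p).
Proof. by rewrite /local_map /coord /= fwdK //; exact: chart_at_dom. Qed.

Lemma smooth_map_at_comp M N P (f : M -> N) (g : N -> P) p :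
  smooth_map_at f p -> smooth_map_at g (f p) -> smooth_map_at (g \o f) p.
Proof.
move=> [cf sf] [cg sg]; split; first exact: continuous_comp.
apply: smooth_at_ext (near_local_map_comp g cf) _.
by apply: smooth_at_comp sf _; rewrite local_map_coord.
Qed.

Lemma tmap_comp M N P (f : M -> N) (g : N -> P) p v :
  smooth_map_at f p -> smooth_map_at g (f p) ->
  tmap (g \o f) p v = tmap g (f p) (tmap f p v).
Proof.
move=> [cf sf] [cg sg].
have df := smooth_at_differentiable sf.
have dg := smooth_at_differentiable sg.
rewrite -local_map_coord in dg.
have dgf := differentiable_comp df dg.
apply: etrans (esym (near_eq_diff v (near_local_map_comp g cf) dgf)) _.
apply: etrans (diff_compE v df dg) _.
by rewrite /tmap local_map_coord.
Qed.

Lemma near_eq_local_map M N (f g : M -> N) p :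
  (\forall q \near p, f q = g q) ->
  \forall x \near coord p, local_map f p x = local_map g p x.
Proof.
move=> fg; apply: filterS (near_chart (chart_at_dom p) fg) => x [_ E].
by rewrite /local_map /= E (nbhs_singleton fg).
Qed.

Lemma near_eq_tmap M N (f g : M -> N) p v :
  (\forall q \near p, f q = g q) -> smooth_map_at f p -> tmap f p v = tmap g p v.
Proof.
move=> fg [_ /smooth_at_differentiable df].
exact: near_eq_diff (near_eq_local_map fg) df.
Qed.

Lemma near_local_map_id M (p : M) :
  \forall x \near coord p, x = local_map id p x.
Proof.
have nA := near_chart (chart_at_dom p) (near_dom (chart_at_dom p)).
by apply: filterS nA => x [cx _]; rewrite /local_map /= bwdK.
Qed.

Lemma smooth_map_at_id M (p : M) : smooth_map_at id p.
Proof.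
split; first exact: cvg_id.
exact: smooth_at_ext (near_local_map_id p) (smooth_at_id _).
Qed.

Lemma tmap_id M (p : M) v : tmap id p v = v.
Proof.
have [d E] := is_diff_id (coord p).
apply: etrans (esym (near_eq_diff v (near_local_map_id p) d)) _.
exact: (congr1 (fun h : _ -> _ => h v) E).
Qed.

Lemma to_tangentE M (c : chart R M (mdim M)) p v : dom c p ->
  to_tangent c (fwd c p) v = 'd (fwd (chart_at p) \o bwd c) (fwd c p) v.
Proof. by move=> cp; rewrite /to_tangent fwdK. Qed.

(** Both sides are the differential at fwd c p of the expression of f in the
    charts c and chart_at (f p), computed in two ways by the chain rule. This is
    what reduces statements on forms to statements on local expressions. *)
Lemma tmap_chart M N (f : M -> N) p c c' v :
  smooth_map_at f p -> atlas c -> atlas c' -> dom c p -> dom c' (f p) ->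
  to_tangent c' (fwd c' (f p)) ('d (fwd c' \o f \o bwd c) (fwd c p) v) =
  tmap f p (to_tangent c (fwd c p) v).
Proof.
move=> sf ac ac' cp c'p; have [cf sf'] := sf.
have ap := chart_at_atlas p; have afp := chart_at_atlas (f p).
have dp := chart_at_dom p; have dfp := chart_at_dom (f p).
rewrite !to_tangentE //.
have d1 := smooth_at_differentiable (smooth_map_at_charts sf ac ac' cp c'p).
have d2 := smooth_at_differentiable (transition_smooth ac' afp c'p dfp).
have d3 := smooth_at_differentiable (transition_smooth ac ap cp dp).
have d4 := smooth_at_differentiable sf'.
have E1 : (fwd c' \o f \o bwd c) (fwd c p) = fwd c' (f p) by rewrite /= fwdK.
have E2 : (fwd (chart_at p) \o bwd c) (fwd c p) = coord p by rewrite /= fwdK.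
rewrite -E1 in d2 *; rewrite -E2 in d4.
apply: etrans (esym (diff_compE v d1 d2)) _.
rewrite /tmap -E2; apply: etrans _ (diff_compE v d3 d4).
apply: near_eq_diff (differentiable_comp d1 d2).
have nd : \forall q \near p, dom c' (f q) := cf _ (near_dom c'p).
have nA : \forall q \near p, dom (chart_at p) q /\ dom c' (f q).
  exact: (filterI (near_dom dp) nd).
apply: filterS (near_chart cp nA) => x [_ [px c'x]].
by rewrite /local_map /= !fwdK.
Qed.

End Charts.

(** * Differentiating multilinear expressions *)

Section Multilinear.
Context {R : realType}.

Lemma dfwithE (I : eqType) (T : Type) (v : I -> T) (i : I) (x : T) j :
  dfwith v i x j = if j == i then x else v j.
Proof. by case: dfwithP => [|k ki]; rewrite ?eqxx // eq_sym (negbTE ki). Qed.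

Lemma dfwith_comp (I : eqType) (T T' : Type) (f : T -> T') (v : I -> T) i x :
  (fun j => f (dfwith v i x j)) = dfwith (fun j => f (v j)) i (f x).
Proof. by apply/funext => j; rewrite !dfwithE; case: ifP. Qed.

Lemma dfwith_id (I : eqType) (T : Type) (v : I -> T) i : dfwith v i (v i) = v.
Proof. by apply/funext => j; rewrite dfwithE; case: eqP => [->|]. Qed.

Definition multilinear n k (a : ('I_k -> 'rV[R]_n) -> R) : Prop :=
  forall v i (b : R) (x y : 'rV[R]_n),
    a (dfwith v i (b *: x + y)) = b * a (dfwith v i x) + a (dfwith v i y).

Lemma multilinear_expand n k (a : ('I_k -> 'rV[R]_n) -> R) v i x :
  multilinear a -> a (dfwith v i x) =
    \sum_l x ord0 l * a (dfwith v i (delta_mx ord0 l)).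
Proof.
move=> la; have lb : linear (fun x => a (dfwith v i x) : R^o).
  by move=> b y z; exact: la.
pose L : {linear 'rV[R]_n -> R^o} := HB.pack (fun x => a (dfwith v i x) : R^o)
  (GRing.isLinear.Build _ _ _ _ _ lb).
exact: (linear_rV_expand L x).
Qed.

Definition fcons (T : Type) k (x : T) (w : 'I_k -> T) : 'I_k.+1 -> T :=
  fun i => oapp w x (unlift ord0 i).

Lemma fcons0 (T : Type) k (x : T) (w : 'I_k -> T) : fcons x w ord0 = x.
Proof. by rewrite /fcons unlift_none. Qed.

Lemma fconsS (T : Type) k (x : T) (w : 'I_k -> T) j :
  fcons x w (lift ord0 j) = w j.
Proof. by rewrite /fcons liftK. Qed.

Lemma fcons_eta (T : Type) k (w : 'I_k.+1 -> T) :
  fcons (w ord0) (fun j => w (lift ord0 j)) = w.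
Proof.
by apply/funext => i; case: (unliftP ord0 i) => [j|] ->; rewrite ?fconsS ?fcons0.
Qed.

Lemma dfwith_fcons0 (T : Type) k (x y : T) (w : 'I_k -> T) :
  dfwith (fcons x w) ord0 y = fcons y w.
Proof.
apply/funext => i; rewrite dfwithE.
by case: (unliftP ord0 i) => [j|] ->; rewrite ?eqxx ?fcons0 // !fconsS.
Qed.

Lemma dfwith_fconsS (T : Type) k (x y : T) (w : 'I_k -> T) j :
  dfwith (fcons x w) (lift ord0 j) y = fcons x (dfwith w j y).
Proof.
apply/funext => i; rewrite dfwithE.
case: (unliftP ord0 i) => [l|] ->; last by rewrite !fcons0.
by rewrite !fconsS dfwithE (inj_eq (@lift_inj _ ord0)).
Qed.

Lemma multilinear_fcons n k (a : ('I_k.+1 -> 'rV[R]_n) -> R) e :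
  multilinear a -> multilinear (fun w => a (fcons e w)).
Proof. by move=> la v i b x y; rewrite -!dfwith_fconsS la. Qed.

Lemma multilinear_head n k (a : ('I_k.+1 -> 'rV[R]_n) -> R) x w :
  multilinear a ->
  a (fcons x w) = \sum_l x ord0 l * a (fcons (delta_mx ord0 l) w).
Proof.
move=> la; rewrite -(dfwith_fcons0 x) (multilinear_expand _ _ la).
by apply: eq_bigr => l _; rewrite dfwith_fcons0.
Qed.

(** Expanding the first argument in the standard basis makes the expression a
    sum of products of a smooth coordinate with an expression that has one
    variable argument less. *)
Lemma smooth_at_multilinear (V : normedModType R) n k
    (T : V -> ('I_k -> 'rV[R]_n) -> R) (A : 'I_k -> V -> 'rV[R]_n) x :
  (forall y, multilinear (T y)) ->
  (forall w, smooth_at (fun y => T y w : R^o) x) ->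
  (forall j, smooth_at (A j) x) ->
  smooth_at (fun y => T y (fun j => A j y) : R^o) x.
Proof.
elim: k T A => [|k IH] T A lT sT sA.
  rewrite (_ : (fun _ => _) = fun y => T y (fun=> 0)); first exact: sT.
  by apply/funext => y; congr (T y _); apply/funext => -[].
rewrite (_ : (fun _ => _) = fun y => \sum_l A ord0 y ord0 l *:
    (T y (fcons (delta_mx ord0 l) (fun j => A (lift ord0 j) y)) : R^o)).
  apply: smooth_at_sum => l; apply: smooth_at_scale; first exact: smooth_at_coord.
  apply: (IH (fun y w => T y (fcons (delta_mx ord0 l) w))) => // y.
  exact: multilinear_fcons.
apply/funext => y; rewrite -[in LHS](fcons_eta (fun j => A j y)).
exact: multilinear_head.
Qed.

Lemma diff_sumE (V W : normedModType R) (I : Type) (r : seq I)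
    (f : I -> V -> W) x v : (forall i, differentiable (f i) x) ->
  differentiable (fun y => \sum_(i <- r) f i y) x /\
  'd (fun y => \sum_(i <- r) f i y) x v = \sum_(i <- r) 'd (f i) x v.
Proof.
move=> df; elim: r => [|i r [d E]].
  rewrite big_nil (_ : (fun _ => _) = cst 0).
    by split; [exact: differentiable_cst|rewrite diff_cst].
  by apply/funext => y; rewrite big_nil.
rewrite big_cons (_ : (fun _ => _) = f i + (fun y => \sum_(j <- r) f j y)).
  split; first exact: differentiableD (df i) d.
  apply: etrans (congr1 (fun h : _ -> _ => h v) (diffD (df i) d)) _.
  by congr (_ + _).
by apply/funext => y; rewrite big_cons.
Qed.

(** Leibniz's rule: T itself is differentiated, then each argument in turn. The
    induction is the one of smooth_at_multilinear. *)
Lemma diff_multilinear (V : normedModType R) n k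
    (T : V -> ('I_k -> 'rV[R]_n) -> R) (A : 'I_k -> V -> 'rV[R]_n) x v :
  (forall y, multilinear (T y)) ->
  (forall w, differentiable (fun y => T y w) x) ->
  (forall j, differentiable (A j) x) ->
  differentiable (fun y => T y (fun j => A j y)) x /\
  'd (fun y => T y (fun j => A j y)) x v =
    'd (fun y => T y (fun j => A j x)) x v +
    \sum_j T x (dfwith (fun j => A j x) j ('d (A j) x v)).
Proof.
elim: k T A => [|k IH] T A lT dT dA.
  rewrite (_ : (fun _ => _) = fun y => T y (fun j => A j x)).
    by split; [exact: dT|rewrite big_ord0 addr0].
  by apply/funext => y; congr (T y _); apply/funext => -[].
pose w y j := A (lift ord0 j) y.
pose e l : 'rV[R]_n := delta_mx ord0 l.
have Tl y z u : T y (fcons z u) = \sum_l z ord0 l * T y (fcons (e l) u).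
  exact: multilinear_head.
have IHl l := IH (fun y u => T y (fcons (e l) u)) (fun j => A (lift ord0 j))
  (fun y => multilinear_fcons (e l) (lT y)) (fun u => dT _)
  (fun j => dA (lift ord0 j)).
have dc l := diff_coord l v (dA ord0).
have E y : T y (fun j => A j y) =
    \sum_l A ord0 y ord0 l *: (T y (fcons (e l) (w y)) : R^o).
  by rewrite -[in LHS](fcons_eta (fun j => A j y)) Tl.
have Ex : (fun j => A j x) = fcons (A ord0 x) (w x).
  exact: esym (fcons_eta (fun j => A j x)).
have dl l : differentiable
    (fun y => A ord0 y ord0 l *: (T y (fcons (e l) (w y)) : R^o)) x.
  by apply: differentiable_scale; [have [] := dc l|have [] := IHl l].
have [ds Es] := diff_sumE (index_enum _) v dl.
rewrite (funext E); split; first exact: ds.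
apply: etrans Es _; rewrite Ex.
have dlx l : differentiable
    (fun y => A ord0 x ord0 l *: (T y (fcons (e l) (w x)) : R^o)) x.
  by apply: differentiableZ; exact: dT.
have S1 : 'd (fun y => T y (fcons (A ord0 x) (w x))) x v =
    \sum_l A ord0 x ord0 l * 'd (fun y => T y (fcons (e l) (w x))) x v.
  apply: etrans (congr1 (fun f : V -> R => 'd f x v)
    (funext (fun y => Tl y _ _))) _.
  have [_ Esx] := diff_sumE (index_enum _) v dlx.
  apply: etrans Esx _; apply: eq_bigr => l _.
  exact: (congr1 (fun h : _ -> _ => h v)
    (diffZ (A ord0 x ord0 l) (dT (fcons (e l) (w x))))).
have S2 : \sum_j T x (dfwith (fcons (A ord0 x) (w x)) j ('d (A j) x v)) =
    \sum_l 'd (A ord0) x v ord0 l * T x (fcons (e l) (w x)) +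
    \sum_l \sum_j A ord0 x ord0 l *
      T x (fcons (e l) (dfwith (w x) j ('d (A (lift ord0 j)) x v))).
  rewrite big_ord_recl dfwith_fcons0 Tl exchange_big; congr (_ + _).
  by apply: eq_bigr => j _; rewrite dfwith_fconsS Tl.
apply: etrans (esym (congr2 (fun a b => a + b) S1 S2)).
rewrite addrCA addrC -!big_split; apply: eq_bigr => l _ /=.
have [dA0 EA0] := dc l; have [dI EI] := IHl l.
apply: etrans (diff_scale v dA0 dI) _.
rewrite -mulr_sumr -mulrDr; apply: congr2.
  by apply: (congr1 (fun r : R => A ord0 x ord0 l * r)).
exact: (congr1 (fun r : R => r * T x (fcons (e l) (w x)))).
Qed.

End Multilinear.

(** * Alternating forms *)

Section Alternating.
Context {R : realType}.

Section Swap.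
Variables (n k : nat) (a : ('I_k -> 'rV[R]_n) -> R).
Hypothesis alt_a : alternating_form a.

(** Expand the value of a with w i + w j in both of the slots i and j, which is
    zero. *)
Lemma alternating_swap (w : 'I_k -> 'rV[R]_n) i j : i != j ->
  a (w \o tperm i j) = - a w.
Proof.
move=> ij; have [la za] := alt_a.
pose D x y := dfwith (dfwith w i x) j y.
have Dij x y l : D x y l = if l == j then y else if l == i then x else w l.
  by rewrite /D !dfwithE.
have aDr x y z : a (D x (y + z)) = a (D x y) + a (D x z).
  by rewrite -[y]scale1r la mul1r scale1r.
have DC x y : D x y = dfwith (dfwith w j y) i x.
  apply/funext => l; rewrite Dij !dfwithE; case: (eqVneq l j) => [->|//].
  by rewrite eq_sym (negbTE ij).
have aDl x y z : a (D (x + y) z) = a (D x z) + a (D y z).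
  by rewrite !DC -[x]scale1r la mul1r scale1r.
have aD0 x : a (D x x) = 0.
  by apply: (za _ i j ij); rewrite !Dij eqxx (negbTE ij) eqxx.
have := aD0 (w i + w j); rewrite aDr !aDl !aD0 add0r addr0.
have -> : D (w i) (w j) = w.
  apply/funext => l; rewrite Dij; case: eqP => [->//|_].
  by case: eqP => [->|].
have -> : D (w j) (w i) = w \o tperm i j.
  apply/funext => l; rewrite Dij /=.
  by case: tpermP => [->|->|/eqP/negbTE-> /eqP/negbTE->//];
    rewrite ?eqxx // (negbTE ij).
by move/eqP; rewrite addr_eq0 => /eqP.
Qed.
End Swap.

Variables (n k : nat) (a : ('I_k -> 'rV[R]_n) -> R).
Hypothesis alt_a : alternating_form a.

Let omit (w : 'I_k.+1 -> 'rV[R]_n) (p : 'I_k.+1) : R :=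
  (-1) ^+ p * a (fun m => w (lift p m)).

(** By induction on q - p, moving the second of the equal vectors to the left
    by transpositions of neighbours: each one changes the sign of the first
    term because a is alternating, and of the second one because q drops by
    one. *)
Let alternating_omit_lt d (w : 'I_k.+1 -> 'rV[R]_n) (p q : 'I_k.+1) :
  q = (p + d.+1)%N :> nat -> w p = w q -> omit w p + omit w q = 0.
Proof.
elim: d w q => [|d IH] w q qE wpq.
  rewrite /omit qE addn1 exprS mulN1r mulNr; apply/eqP; rewrite subr_eq0.
  apply/eqP; congr (_ * a _); apply/funext => m.
  case: (ltngtP m p) => mp.
  - by congr (w _); apply: val_inj; rewrite /= /bump qE; lia.
  - by congr (w _); apply: val_inj; rewrite /= /bump qE; lia.
  have -> : lift p m = q by apply: val_inj; rewrite /= /bump qE; lia.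
  by rewrite -wpq; congr (w _); apply: val_inj; rewrite /= /bump qE; lia.
have q'lt : (p + d.+1 < k.+1)%N by have := ltn_ord q; lia.
pose q' := Ordinal q'lt.
have q'v : nat_of_ord q' = (p + d.+1)%N by [].
have q'q : q' != q by apply/eqP => /(congr1 (@nat_of_ord _)) /=; lia.
have pq' : p != q' by apply/eqP => /(congr1 (@nat_of_ord _)) /=; lia.
have pq : p != q by apply/eqP => /(congr1 (@nat_of_ord _)) /=; lia.
pose w' := w \o tperm q' q.
have w'p : w' p = w' q'.
  by rewrite /w' /= tpermL tpermD // eq_sym.
have := IH w' q' erefl w'p.
have -> : omit w' q' = - omit w q.
  rewrite /omit (_ : nat_of_ord q = q'.+1) ?exprS ?mulN1r ?mulNr ?opprK;
    last by rewrite /=; lia.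
  congr (_ * a _).
  apply/funext => m; rewrite /w' /=; congr (w _).
  case: (ltngtP m q') => mq.
  - have -> : lift q m = lift q' m by apply: val_inj; rewrite /= /bump qE; lia.
    by rewrite tpermD //; apply/eqP => /(congr1 (@nat_of_ord _));
      rewrite /= /bump; lia.
  - have -> : lift q m = lift q' m by apply: val_inj; rewrite /= /bump qE; lia.
    by rewrite tpermD //; apply/eqP => /(congr1 (@nat_of_ord _));
      rewrite /= /bump; lia.
  have -> : lift q' m = q by apply: val_inj; rewrite /= /bump qE; lia.
  by rewrite tpermR; apply: val_inj; rewrite /= /bump qE; lia.
have [j' q'E _] := unlift_some pq'; have [j qjE _] := unlift_some pq.
have -> : omit w' p = - omit w p.
  rewrite /omit -mulrN; congr (_ * _).
  have jj : j' != j.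
    by apply: contraNneq q'q => jE; rewrite q'E qjE jE.
  rewrite -(alternating_swap alt_a (fun m => w (lift p m)) jj); congr a.
  apply/funext => m; rewrite /w' /= q'E qjE.
  by rewrite -(inj_tperm _ _ _ (@lift_inj _ p)).
by rewrite -opprD => /eqP; rewrite oppr_eq0 => /eqP.
Qed.

Let alternating_omit (w : 'I_k.+1 -> 'rV[R]_n) p q : p != q -> w p = w q ->
  omit w p = - omit w q.
Proof.
move=> pq wpq; apply/eqP; rewrite -addr_eq0; apply/eqP.
case: (ltngtP p q) => [lt|lt|/val_inj/eqP]; last by rewrite (negbTE pq).
  by apply: (@alternating_omit_lt (q - p).-1); [lia|].
by rewrite addrC; apply: (@alternating_omit_lt (p - q).-1); [lia|].
Qed.

(** In the double sum the terms with (omitted index, changed index) equal to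
    (i, q) and to (q, i) are opposite: both are values of a on the family with
    H i q in the two slots i and q, one slot being omitted. This is the reason
    why second derivatives disappear from the differential of a pullback. *)
Lemma alternating_symmetric_sum (A : 'I_k.+1 -> 'rV[R]_n)
    (H : 'I_k.+1 -> 'I_k.+1 -> 'rV[R]_n) : (forall i j, H i j = H j i) ->
  \sum_(i < k.+1) (-1) ^+ i *
    \sum_j a (dfwith (fun m => A (lift i m)) j (H (lift i j) i)) = 0.
Proof.
move=> HC; pose W i q := dfwith (dfwith A q (H q i)) i (H q i).
pose C i q := if q == i then 0 else omit (W i q) i.
have CC i q : C i q = - C q i.
  rewrite /C eq_sym; case: eqVneq => [_|iq]; first by rewrite oppr0.
  have -> : W i q = W q i.
    apply/funext => l; rewrite /W !dfwithE HC.
    by case: (eqVneq l i) => // ->; case: eqP.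
  by apply: alternating_omit => //; rewrite /W !dfwithE !eqxx; case: eqP.
have -> : \sum_(i < k.+1) (-1) ^+ i *
    \sum_j a (dfwith (fun m => A (lift i m)) j (H (lift i j) i)) =
    \sum_i \sum_q C i q.
  apply: eq_bigr => i _.
  rewrite [RHS](@bigD1_ord _ _ _ _ i) // /C eqxx /= add0r mulr_sumr.
  apply: eq_bigr => j _; rewrite eq_sym (negbTE (neq_lift _ _)) /omit.
  congr (_ * a _); apply/funext => m; rewrite /W !dfwithE.
  by rewrite (eq_sym _ i) (negbTE (neq_lift _ _)) (inj_eq (@lift_inj _ i)).
set S := \sum_i _; have : S = - S.
  rewrite {1}/S exchange_big -sumrN; apply: eq_bigr => i _.
  by rewrite -sumrN; apply: eq_bigr => q _.
by move/eqP; rewrite -subr_eq0 opprK -mulr2n mulrn_eq0 => /eqP.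
Qed.

End Alternating.

(** * Pullback of differential forms *)

Section SecondDerivative.
Context {R : realType}.

(** Schwarz's theorem in each coordinate. *)
Lemma smooth_diffC (V : normedModType R) n (f : V -> 'rV[R]_n) x u v :
  smooth_at f x ->
  'd (fun y => 'd f y u) x v = 'd (fun y => 'd f y v) x u.
Proof.
move=> sf; apply/rowP => i.
pose fi y := f y ord0 i.
have sfi : smooth_at (fi : V -> R^o) x by exact: smooth_at_coord.
have E w w' : 'd (fun y => 'd f y w) x w' ord0 i = 'd (fun y => 'd fi y w) x w'.
  have dw := smooth_at_differentiable (smooth_at_diff w sf).
  have [dc <-] := diff_coord i w' dw.
  apply: near_eq_diff dc; apply: filterS (near_smooth_at sf) => y.
  by move=> /smooth_at_differentiable df; have [_ ->] := diff_coord i w df.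
rewrite !E; apply: diff_diffC.
- by apply: filterS (near_smooth_at sfi) => y; exact: smooth_at_differentiable.
- exact: smooth_at_differentiable (smooth_at_diff u sfi).
- exact: smooth_at_differentiable (smooth_at_diff v sfi).
Qed.

End SecondDerivative.

Section Pullback.
Context {R : realType}.
Implicit Types M N P : manifold R.

Definition pullback M N k (f : M -> N) (omega : preform N k) : preform M k :=
  fun p v => omega (f p) (fun i => tmap f p (v i)).

Lemma pullback_comp M N P k (f : M -> N) (g : N -> P) (omega : preform P k) p :
  smooth_map_at f p -> smooth_map_at g (f p) ->
  pullback (g \o f) omega p = pullback f (pullback g omega) p.
Proof.
move=> sf sg; apply/funext => v; rewrite /pullback /=; congr (omega _ _).
by apply/funext => i; rewrite tmap_comp.
Qed.

Lemma multilinear_comp m n k (a : ('I_k -> 'rV[R]_n) -> R)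
    (f : {linear 'rV[R]_m -> 'rV[R]_n}) :
  multilinear a -> multilinear (fun v => a (fun i => f (v i))).
Proof. by move=> la v i b x y; rewrite !dfwith_comp linearP la. Qed.

Lemma alternating_comp m n k (a : ('I_k -> 'rV[R]_n) -> R)
    (f : {linear 'rV[R]_m -> 'rV[R]_n}) :
  alternating_form a -> alternating_form (fun v => a (fun i => f (v i))).
Proof.
move=> [la za]; split; first exact: multilinear_comp.
by move=> v i j ij vij; apply: (za _ i j ij); rewrite vij.
Qed.

Lemma pullback_alternating M N k (f : M -> N) (omega : preform N k) p :
  alternating_form (omega (f p)) -> alternating_form (pullback f omega p).
Proof. exact: alternating_comp. Qed.

Lemma local_form_alternating M k (c : chart R M (mdim M))
    (omega : preform M k) x :
  is_form omega -> alternating_form (fun v => local_form c omega v x).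
Proof. by move=> [alt_omega _]; exact: alternating_comp. Qed.

Section Charts.
Variables (M N : manifold R) (k : nat) (f : M -> N) (omega : preform N k).
Variables (p : M) (c : chart R M (mdim M)) (c' : chart R N (mdim N)).
Hypotheses (omega_form : is_form omega).
Hypothesis smooth_f : \forall q \near p, smooth_map_at f q.
Hypotheses (ac : atlas c) (ac' : atlas c') (cp : dom c p) (c'p : dom c' (f p)).

Let F := fwd c' \o f \o bwd c.
Let x0 := fwd c p.

Let smooth_fp : smooth_map_at f p. Proof. exact: nbhs_singleton smooth_f. Qed.

Let smooth_F : smooth_at F x0.
Proof. exact: smooth_map_at_charts smooth_fp ac ac' cp c'p. Qed.

Lemma local_form_pullback v : \forall x \near fwd c p,
  local_form c' omega (fun i => 'd F x (v i)) (F x) =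
  local_form c (pullback f omega) v x.
Proof.
have nc' : \forall q \near p, dom c' (f q) := smooth_fp.1 _ (near_dom c'p).
have nc : \forall q \near p, dom c q := near_dom cp.
have nA : \forall q \near p, [/\ smooth_map_at f q, dom c q & dom c' (f q)].
  by apply: filterS3 smooth_f nc nc'.
apply: filterS (near_chart cp nA) => x [cx [sq cq c'q]].
rewrite /local_form /pullback /F /= fwdK //; congr (omega _ _).
apply/funext => i; have := tmap_chart (v i) sq ac ac' cq c'q.
by rewrite (bwdK cx).
Qed.

Let T y (w : 'I_k -> 'rV[R]_(mdim N)) : R := local_form c' omega w (F y).

Let smooth_local w : smooth_at (local_form c' omega w : _ -> R^o) (F x0).
Proof.
have [_ sm] := omega_form; apply: smooth_on_at (sm c' w ac') _.
  exact: cod_open.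
by rewrite /F /x0 /= fwdK //; exact: fwd_cod.
Qed.

Let T_smooth w : smooth_at (fun y => T y w : R^o) x0.
Proof. exact: smooth_at_comp smooth_F (smooth_local w). Qed.

Let T_multilinear y : multilinear (T y).
Proof. by have [] := local_form_alternating c' (F y) omega_form. Qed.

Lemma smooth_local_pullback v :
  smooth_at (local_form c (pullback f omega) v : _ -> R^o) (fwd c p).
Proof.
apply: smooth_at_ext (local_form_pullback v) _.
apply: (smooth_at_multilinear (T := T) (A := fun i x => 'd F x (v i))) => // i.
exact: smooth_at_diff.
Qed.

(** Leibniz's rule for the local expression of the pullback: the coefficients of
    omega are differentiated in the first term, the vectors 'd F x (v i) to
    which they are applied in the other ones. *)
Lemma diff_local_pullback v u :
  'd (local_form c (pullback f omega) v) x0 u =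
  'd (local_form c' omega (fun i => 'd F x0 (v i))) (F x0) ('d F x0 u) +
  \sum_j local_form c' omega (dfwith (fun i => 'd F x0 (v i)) j
    ('d (fun x => 'd F x (v j)) x0 u)) (F x0).
Proof.
have dA j := smooth_at_differentiable (smooth_at_diff (v j) smooth_F).
have dT w := smooth_at_differentiable (T_smooth w).
have [d E] := diff_multilinear u T_multilinear dT dA.
apply: etrans (esym (near_eq_diff u (local_form_pullback v) d)) _.
apply: etrans E _; congr (_ + _).
have dF := smooth_at_differentiable smooth_F.
have dl := smooth_at_differentiable
  (smooth_local (fun i => 'd F x0 (v i))).
exact: diff_compE u dF dl.
Qed.

End Charts.

Lemma pullback_is_form M N k (f : M -> N) (omega : preform N k) :
  smooth_map f -> is_form omega -> is_form (pullback f omega).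
Proof.
move=> sf fo; split=> [p|c v ac].
  by apply: pullback_alternating; have [] := fo.
apply: (@smooth_at_on _ _ R^o) => x cx; rewrite -(bwdK cx).
have nf : \forall q \near bwd c x, smooth_map_at f q by exact: nearW.
exact: (smooth_local_pullback fo nf ac (chart_at_atlas _)
  (bwd_dom cx) (chart_at_dom _) v).
Qed.

(** In the alternating sum that defines dR, the first terms of Leibniz's rule
    give the pullback of dR omega; the other ones involve the symmetric second
    derivatives of the local expression of f and cancel. *)
Lemma dR_pullback M N k (f : M -> N) (omega : preform N k) :
  smooth_map f -> is_form omega -> dR (pullback f omega) = pullback f (dR omega).
Proof.
move=> sf fo; apply/funext => p; apply/funext => v.
have nf : \forall q \near p, smooth_map_at f q by exact: nearW.
rewrite {2}/pullback /dR.
pose F := local_map f p; pose x0 := coord p.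
have smF : smooth_at F x0 by have [] := sf p.
pose a w := local_form (chart_at (f p)) omega w (F x0).
have alt_a : alternating_form a by exact: local_form_alternating.
pose A i := 'd F x0 (v i).
pose H i j := 'd (fun x => 'd F x (v i)) x0 (v j).
have HC i j : H i j = H j i by exact: smooth_diffC.
have E (i : 'I_k.+1) := diff_local_pullback fo nf (chart_at_atlas p)
  (chart_at_atlas (f p)) (chart_at_dom p) (chart_at_dom (f p))
  (fun j => v (lift i j)) (v i).
have S0 := alternating_symmetric_sum alt_a A HC.
pose D (i : 'I_k.+1) : R := 'd (local_form (chart_at (f p)) omega
  (fun j => A (lift i j))) (F x0) (A i).
pose S (i : 'I_k.+1) : R :=
  \sum_j a (dfwith (fun m => A (lift i m)) j (H (lift i j) i)).
apply: (@etrans _ _ (\sum_(i < k.+1) ((-1) ^+ i * D i + (-1) ^+ i * S i))).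
  apply: eq_bigr => i _; rewrite -mulrDr.
  exact: (congr1 (fun r : R => (-1) ^+ i * r) (E i)).
rewrite big_split /= S0 addr0 /D /F /x0 local_map_coord.
by [].
Qed.

End Pullback.

(** * Euclidean test manifolds and local sections of submersions *)

Section Euclidean.
Context {R : realType}.
Variable n : nat.

(** Balls of radius 1/(m+1) around rational points. *)
Lemma rV_second_countable : @second_countable 'rV[R]_n.
Proof.
pose f (qm : 'rV[rat]_n * nat) : set 'rV[R]_n :=
  ball (map_mx (ratr : rat -> R) qm.1) (qm.2.+1%:R^-1 : R).
exists (range f).
  exact: sub_countable (card_image_le f setT) (countableP _).
split=> [_ [qm _ <-]|x A /nbhs_ballP[e /= e0 eA]]; first exact: ball_open.
have [m me] : exists m : nat, m.+1%:R^-1 < e / 2.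
  have e20 : 0 < e / 2 by rewrite divr_gt0.
  have [m _ H] := near_infty_natSinv_lt (PosNum e20).
  by exists m; apply: H => /=.
pose d : R := m.+1%:R^-1; have d0 : 0 < d by rewrite invr_gt0.
have H (i : 'I_n) : exists q : rat, `|x ord0 i - ratr q| < d.
  have [|q] := @rat_in_itvoo R (x ord0 i - d) (x ord0 i + d).
    by rewrite ltrD2l gtrN.
  rewrite in_itv /= => /andP[q1 q2]; exists q.
  by rewrite ltr_norml; apply/andP; split; lra.
pose q : 'rV[rat]_n := \row_i projT1 (cid (H i)).
have qx : ball (map_mx (ratr : rat -> R) q : 'rV[R]_n) d x.
  apply/ball_sym; split=> // i j; rewrite ord1 !mxE.
  exact: projT2 (cid (H j)).
exists (f (q, m)); first by split=> //; exists (q, m).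
apply: subset_trans eA => y qy; apply: (@le_ball _ _ x (d + d)).
  by move: me; rewrite -/d; lra.
exact: ball_triangle (ball_sym qx) qy.
Qed.

Let id_continuous (p : 'rV[R]_n) : setT p -> {for p, continuous id}.
Proof. by move=> _; exact: cvg_id. Qed.

Definition euclidean_chart : chart R 'rV[R]_n n :=
  @Chart R 'rV[R]_n n setT setT id id openT openT
    (fun _ Tp => Tp) (fun _ Tp => Tp) (fun _ _ => erefl) (fun _ _ => erefl)
    id_continuous id_continuous.

Let euclidean_atlas_smooth (c c' : chart R 'rV[R]_n n) :
  [set euclidean_chart] c -> [set euclidean_chart] c' ->
  smooth_on (cod c `&` bwd c @^-1` dom c') (fwd c' \o bwd c).
Proof. by move=> -> ->; apply: smooth_at_on => x _; exact: smooth_at_id. Qed.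

Definition euclidean_space : manifold R :=
  @Manifold R 'rV[R]_n n [set euclidean_chart] (fun=> euclidean_chart)
    (fun=> erefl) (fun=> I) euclidean_atlas_smooth
    (@norm_hausdorff R 'rV[R]_n) rV_second_countable.

End Euclidean.

Arguments euclidean_chart R n : clear implicits.
Arguments euclidean_space R n : clear implicits.

Section Parametrization.
Context {R : realType}.

(** With shrink this is x / (1 + |x|^2), |.| being the Euclidean norm: a smooth
    map of R^n into the unit ball whose differential at 0 is the identity. *)
Let shrink_factor n (x : 'rV[R]_n) : R := (1 + \sum_i x ord0 i * x ord0 i)^-1.
Let shrink n (x : 'rV[R]_n) : 'rV[R]_n := shrink_factor x *: x.

Let denom_gt0 n (x : 'rV[R]_n) : 0 < 1 + \sum_i x ord0 i * x ord0 i.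
Proof.
by rewrite ltr_pwDl // sumr_ge0 // => i _; rewrite -expr2 sqr_ge0.
Qed.

Let smooth_shrink_factor n (x : 'rV[R]_n) :
  smooth_at (@shrink_factor n : _ -> R^o) x.
Proof.
apply: (@smooth_atV _ _ (fun y : 'rV[R]_n => 1 + \sum_i y ord0 i * y ord0 i)).
  apply: (@smooth_atD _ _ R^o (cst 1)); first exact: smooth_at_cst.
  apply: (@smooth_at_sum _ _ R^o) => i.
  apply: (@smooth_at_scale _ _ R^o); exact: smooth_at_coord (smooth_at_id _).
by rewrite gt_eqF.
Qed.

Let smooth_shrink n (x : 'rV[R]_n) : smooth_at (@shrink n) x.
Proof.
by apply: smooth_at_scale; [exact: smooth_shrink_factor|exact: smooth_at_id].
Qed.

Let shrink_lt1 n (x : 'rV[R]_n) : `|shrink x| <= 1.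
Proof.
apply: rV_norm_le => // i; rewrite /shrink mxE /shrink_factor.
have d0 : 0 < 1 + \sum_i x ord0 i * x ord0 i by exact: denom_gt0.
rewrite normrM gtr0_norm ?invr_gt0 // [leLHS]mulrC ler_pdivrMr // mul1r.
rewrite (bigD1 i) //= -expr2 -(real_normK (num_real (x ord0 i))).
have S0 : 0 <= \sum_(j < n | j != i) x ord0 j * x ord0 j.
  by rewrite sumr_ge0 // => j _; rewrite -expr2 sqr_ge0.
by have := sqr_ge0 (`|x ord0 i| - 1); have := sqr_ge0 `|x ord0 i|; nra.
Qed.

Let shrink0 n : shrink (0 : 'rV[R]_n) = 0.
Proof. by rewrite /shrink scaler0. Qed.

Let diff_shrink0 n (v : 'rV[R]_n) : 'd (@shrink n) 0 v = v.
Proof.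
have da := smooth_at_differentiable (smooth_shrink_factor (0 : 'rV[R]_n)).
have [di Ei] := is_diff_id (0 : 'rV[R]_n).
apply: etrans (diff_scale v da di) _.
rewrite Ei scaler0 addr0 /shrink_factor big1 ?addr0 ?invr1 ?scale1r //.
by move=> i _; rewrite mxE mulr0.
Qed.

(** Fiber products and full faithfulness are tested on smooth maps that are
    defined on a whole manifold, whereas sections of submersions are only local.
    Shrinking R^n into a chart gives a globally defined theta with values in any
    given neighbourhood of m, which is enough to reach every tangent vector
    at m. *)
Lemma local_parametrization (M : manifold R) (m : M) (U : set M) :
  (\forall q \near m, U q) ->
  exists theta : euclidean_space R (mdim M) -> M,
    [/\ smooth_map theta, theta (0 : 'rV[R]_(mdim M)) = m,
        forall x, U (theta x) &
        forall v, exists u, tmap theta (0 : 'rV[R]_(mdim M)) u = v].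
Proof.
move=> nU; set c := chart_at m; have dm : dom c m := chart_at_dom m.
have [e /= e0 He] := iffLR (nbhs_ballP _ _) (near_chart dm nU).
pose L : {linear 'rV[R]_(mdim M) -> 'rV[R]_(mdim M)} := *:%R (e / 2).
have cL : continuous L by exact: continuous_linear_rV.
pose a x : 'rV[R]_(mdim M) := fwd c m + L (shrink x).
have Ha x : cod c (a x) /\ U (bwd c (a x)).
  apply: He; rewrite -ball_normE /= /a opprD addrA subrr sub0r normrN normrZ.
  rewrite gtr0_norm ?divr_gt0 //.
  have : e / 2 * `|shrink x| <= e / 2.
    by rewrite ler_piMr ?shrink_lt1 // ltW // divr_gt0.
  by move=> /le_lt_trans; apply; rewrite ltr_pdivrMr // mulr_natr mulr2n ltrDl.
have sa x : smooth_at a x.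
  have sL := smooth_at_affine (fwd c m) (shrink x) cL.
  exact: smooth_at_comp (smooth_shrink x) sL.
pose theta (x : euclidean_space R (mdim M)) : M := bwd c (a x).
have theta0 : theta (0 : 'rV[R]_(mdim M)) = m
  by rewrite /theta /a shrink0 linear0 addr0 fwdK.
have fwd_theta : fwd c \o theta = a.
  by apply/funext => x; rewrite /theta /= bwdK //; have [] := Ha x.
exists theta; split=> // [x|x|v].
- have ct : {for x, continuous theta}.
    apply: (@continuous_comp _ _ _ a (bwd c)).
      exact: smooth_at_continuous.
    by apply: bwd_continuous; have [] := Ha x.
  apply: (@charts_smooth_map_at _ (euclidean_space R (mdim M)) M theta x
    (euclidean_chart R (mdim M)) c ct erefl (chart_at_atlas m) I).
    by apply: bwd_dom; have [] := Ha x.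
  rewrite -[_ \o bwd _]/(fwd c \o theta) fwd_theta; exact: sa.
- by have [] := Ha x.
exists ((e / 2)^-1 *: v).
have e2 : e / 2 != 0 by rewrite gt_eqF // divr_gt0.
rewrite /tmap /local_map theta0.
rewrite -[X in 'd X _ _]/(fwd c \o theta) fwd_theta.
have ds := smooth_at_differentiable (smooth_shrink (0 : 'rV[R]_(mdim M))).
have [dL EL] := is_diff_affine (fwd c m) (shrink (0 : 'rV[R]_(mdim M))) cL.
apply: etrans (diff_compE _ ds dL) _.
apply: etrans (congr1 (fun h : _ -> _ => h _) EL) _.
apply: etrans (congr1 L (diff_shrink0 _)) _.
exact: (scalerKV e2 v).
Qed.

End Parametrization.

Section LocalSection.
Context {R : realType}.

(** Restricted to the affine subspace through z in the direction of a complement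
    of the kernel, the local expression of e has an invertible differential; the
    section is its local inverse. *)
Lemma local_section (M N : manifold R) (e : M -> N) (z : M) : submersion e ->
  exists (U : set N) (sigma : N -> M),
    [/\ open U, U (e z), sigma (e z) = z,
        forall q, U q -> smooth_map_at sigma q &
        forall q, U q -> e (sigma q) = q].
Proof.
move=> [se surj_e].
set c := chart_at z; set d := chart_at (e z).
have cz : dom c z := chart_at_dom z.
have dz : dom d (e z) := chart_at_dom (e z).
pose F := local_map e z; pose x0 := coord z; pose y0 := coord (e z).
have Fx0 : F x0 = y0 by exact: local_map_coord.
have [ce [W [oW Wx0 sF]]] := se z.
pose W' := W `&` (cod c `&` (e \o bwd c) @^-1` dom d).
have oW' : open W'.
  apply: openI => //; rewrite openE => x [cx dx].
  have nC := near_open (@cod_open _ _ _ c) cx.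
  have [ceb _] := se (bwd c x).
  have cc : {for x, continuous (e \o bwd c)}.
    exact: continuous_comp (bwd_continuous cx) ceb.
  have nD := cc _ (near_open (@dom_open _ _ _ d) dx).
  exact: (filterI nC nD).
have W'x0 : W' x0.
  by split=> //; split; [exact: fwd_cod|rewrite /preimage /= fwdK].
(* L is a linear right inverse of the differential of F at x0; phi is F along
   the affine subspace through x0 in the direction of the image of L. *)
pose J := 'J F x0.
pose L := mulmxr (pinvmx J) : {linear 'rV[R]_(mdim N) -> 'rV[R]_(mdim M)}.
have cL : continuous L by exact: continuous_linear_rV.
have dFL v : 'd F x0 (L v) = v.
  apply: etrans (esym (mul_rV_lin1 ('d F x0) (L v))) _.
  apply: mulmxKpV; apply/submxP.
  have [u Eu] := surj_e z v; exists u; rewrite -Eu.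
  exact: esym (mul_rV_lin1 ('d F x0) u).
pose a y := (x0 - L y0) + L y.
have ay0 : a y0 = x0 by rewrite /a subrK.
have sa y : smooth_at a y by exact: smooth_at_affine.
pose U0 := setT `&` a @^-1` W'.
have oU0 : open U0.
  apply: open_preimage => // [|y _]; first exact: openT.
  exact: smooth_at_continuous.
have U0y0 : U0 y0 by split=> //; rewrite /preimage /= ay0.
pose phi := F \o a.
have sphi : smooth_on U0 phi.
  apply: smooth_at_on => y [_ [Wy _]].
  exact: smooth_at_comp (sa y) (smooth_on_at oW sF Wy).
have phiy0 : phi y0 = y0 by rewrite /phi /= ay0.
have dphi0 v : 'd phi y0 v = v.
  have [da Ea] := is_diff_affine (x0 - L y0) y0 cL.
  have dF : differentiable F (a y0).
    by rewrite ay0; exact: smooth_at_differentiable (smooth_on_at oW sF Wx0).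
  apply: etrans (diff_compE v da dF) _.
  apply: etrans (congr1 (fun h : _ -> _ => 'd F (a y0) (h v)) Ea) _.
  by rewrite ay0; exact: dFL.
have [V [psi [oV Vy0 spsi psiy0 psiK]]] :=
  local_right_inverse oU0 U0y0 sphi dphi0.
rewrite phiy0 in Vy0 psiy0.
pose U := dom d `&` fwd d @^-1` V.
pose sigma q := bwd c (a (psi (fwd d q))).
have aU q : U q -> W' (a (psi (fwd d q))).
  by move=> [_ /psiK[[_ ]]].
exists U, sigma; split.
- rewrite openE => q [dq Vq].
  have nC := near_open (@dom_open _ _ _ d) dq.
  have nD := fwd_continuous dq (near_open oV Vq).
  exact: (filterI nC nD).
- by [].
- by rewrite /sigma psiy0 ay0; exact: fwdK.
- move=> q Uq; have [dq Vq] := Uq.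
  have [_ [cq _]] := aU q Uq.
  have sap : smooth_at (a \o psi) (fwd d q).
    exact: smooth_at_comp (smooth_on_at oV spsi Vq) (sa _).
  have csig : {for q, continuous sigma}.
    apply: (@continuous_comp _ _ _ (fwd d) (bwd c \o (a \o psi))).
      exact: fwd_continuous.
    apply: continuous_comp; first exact: smooth_at_continuous.
    exact: bwd_continuous.
  apply: (charts_smooth_map_at csig (chart_at_atlas (e z))
    (chart_at_atlas z) dq).
    exact: bwd_dom.
  apply: smooth_at_ext sap.
  have nV := near_open oV Vq.
  have nC := near_open (@cod_open _ _ _ d) (fwd_cod dq).
  apply: filterS2 nV nC => y Vy cy.
  rewrite /sigma /= bwdK // bwdK //.
  by have [[_ [_ []]]] := psiK y Vy.
- move=> q Uq; have [dq Vq] := Uq; have [_ [cq dsq]] := aU q Uq.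
  have [_ Eq] := psiK _ Vq.
  rewrite -[RHS](fwdK dq) -Eq /phi /F /local_map /=.
  by rewrite fwdK.
Qed.

End LocalSection.

(** * Basic forms as forms with equal pullbacks to the arrows *)

Section Curves.
Context {R : realType}.
Implicit Types M N : manifold R.

Lemma smooth_at_curve_comp (V : normedModType R) n (h : R -> 'rV[R]_n)
    (g : 'rV[R]_n -> V) t : smooth_at (h : R^o -> _) t -> smooth_at g (h t) ->
  differentiable (g \o h) t /\ derive1 (g \o h) t = 'd g (h t) (derive1 h t).
Proof.
move=> /smooth_at_differentiable dh /smooth_at_differentiable dg.
have dgh : differentiable (g \o h) t by exact: differentiable_comp dh dg.
split=> //; apply: etrans (derive1E' dgh) _.
by apply: etrans (diff_compE _ dh dg) _; rewrite (derive1E' dh).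
Qed.

Lemma near_eq_derive1 (V : normedModType R) (h h' : R -> V) t :
  (\forall s \near t, h s = h' s) -> differentiable h t ->
  derive1 h t = derive1 h' t.
Proof.
move=> hh' dh; have dh' := near_eq_differentiable hh' dh.
apply: etrans (derive1E' dh) _; apply: etrans _ (esym (derive1E' dh')).
exact: near_eq_diff hh' dh.
Qed.

Lemma velocity_comp M N (f : M -> N) (gamma : R -> M) :
  smooth_curve gamma -> smooth_map_at f (gamma 0) ->
  velocity (f \o gamma) = tmap f (gamma 0) (velocity gamma).
Proof.
move=> [ng sg] [cf sf].
pose h := fwd (chart_at (gamma 0)) \o gamma.
have [d E] := smooth_at_curve_comp (g := local_map f (gamma 0)) sg sf.
apply: etrans _ E; apply: esym; apply: near_eq_derive1 d.
have nd : \forall s \near (0 : R), dom (chart_at (gamma 0)) (gamma s).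
  exact: (nbhs_singleton ng _ (near_dom (chart_at_dom (gamma 0)))).
by apply: filterS nd => s ds; rewrite /local_map /= fwdK.
Qed.

Lemma exists_curve M (p : M) u : exists gamma : R -> M,
  [/\ smooth_curve gamma, gamma 0 = p & velocity gamma = u].
Proof.
set c := chart_at p; have dp : dom c p := chart_at_dom p.
pose l (t : R) : 'rV[R]_(mdim M) := fwd c p + t *: u.
have l0 : l 0 = fwd c p by rewrite /l scale0r addr0.
have dl t := is_diff_line (fwd c p) u t.
have cl t : {for t, continuous l}.
  by have [d _] := dl t; exact: differentiable_continuous.
have sl t : smooth_at (l : R^o -> _) t.
  apply: (@smooth_atD _ R^o _ (cst (fwd c p))); first exact: smooth_at_cst.
  by apply: (@smooth_at_scale _ R^o); [exact: smooth_at_id|exact: smooth_at_cst].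
pose gamma t := bwd c (l t).
have gamma0 : gamma 0 = p by rewrite /gamma l0 fwdK.
have nc : \forall t \near (0 : R), cod c (l t).
  have := cl 0; rewrite /prop_for /continuous_at l0; apply.
  exact: near_open (@cod_open _ _ _ c) (fwd_cod dp).
have nl : \forall t \near (0 : R), l t = (fwd (chart_at (gamma 0)) \o gamma) t.
  by rewrite gamma0; apply: filterS nc => t ct; rewrite /gamma /= bwdK.
exists gamma; split=> //.
  split; last by apply: smooth_at_ext nl _; exact: sl.
  apply: filterS nc => t ct; apply: (@continuous_comp _ _ _ l (bwd c)) => //.
  exact: bwd_continuous.
have [d E] := dl 0; rewrite /velocity.
apply: etrans (esym (near_eq_derive1 nl d)) _.
apply: etrans (derive1E' d) _.
by apply: etrans (congr1 (fun h : _ -> _ => h 1) E) _; rewrite scale1r.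
Qed.

End Curves.

Section BasicForms.
Context {R : realType}.
Variables (G : lie_groupoid R) (k : nat).
Implicit Types omega : preform (objs G) k.

Let smooth_src : smooth_map (@src R G). Proof. by have [] := src_submersion G. Qed.
Let smooth_tgt : smooth_map (@tgt R G). Proof. by have [] := tgt_submersion G. Qed.

Let normal_eq_refl p v : @normal_eq R G p v v.
Proof.
exists 0; split; first exact: linear0.
by rewrite subrr; apply: esym; exact: linear0.
Qed.

(** For vectors u i tangent to the arrows at g, curves with velocity u i show
    that g carries the class of the image of u i under src to the class of its
    image under tgt, so that equality of the pullbacks is an instance of
    invariance. *)
Lemma basic_pullback omega : basic omega ->
  pullback (@src R G) omega = pullback (@tgt R G) omega.
Proof.
move=> [_ _ inv_omega]; apply/funext => g; apply/funext => u.
rewrite /pullback; apply/esym/inv_omega => i.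
have [gamma [sg g0 vg]] := exists_curve g (u i).
exists gamma; split=> //.
  rewrite -[velocity _]/(velocity (@src R G \o gamma)).
  by rewrite (velocity_comp sg (smooth_src _)) g0 vg; exact: normal_eq_refl.
rewrite -[velocity _]/(velocity (@tgt R G \o gamma)).
by rewrite (velocity_comp sg (smooth_tgt _)) g0 vg; exact: normal_eq_refl.
Qed.

Lemma multilinear0 n (a : ('I_k -> 'rV[R]_n) -> R) v i :
  multilinear a -> v i = 0 -> a v = 0.
Proof.
move=> la vi; rewrite -(dfwith_id v i) vi (multilinear_expand _ _ la).
by rewrite big1 // => l _; rewrite mxE mul0r.
Qed.

Let null_horizontal j (omega : preform (objs G) j) :
  (forall p w i a, algebroid p a -> w i = anchor p a -> omega p w = 0) ->
  horizontal omega.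
Proof.
case: j omega => [//|j] omega null X [AX _].
apply/funext => p; apply/funext => v; apply: (null p _ ord0 (X p) (AX p)).
by rewrite unlift_none.
Qed.

Section Descent.
Variable omega : preform (objs G) k.
Hypotheses (fo : is_form omega)
  (st : pullback (@src R G) omega = pullback (@tgt R G) omega).

Let multilinear_omega p : multilinear (omega p).
Proof. by have [/(_ p)[]] := fo. Qed.

(** At the unit arrow of p complete a to vectors u' with tgt-images w. Then
    omega p w is the value of the pullback along tgt, hence along src, on u';
    the latter vanishes since src kills a. *)
Let anchor_null p w i a : algebroid p a -> w i = anchor p a -> omega p w = 0.
Proof.
move=> Aa wi; have [_ surj_t] := tgt_submersion G.
have [u Hu] := fin_all_exists (fun j => surj_t (unit_arr p) (w j)).
pose u' := dfwith u i a.
have E : omega (tgt (unit_arr p))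
    (fun j => tmap (@tgt R G) (unit_arr p) (u' j)) = 0.
  rewrite -[LHS]/(pullback (@tgt R G) omega (unit_arr p) u') -st /pullback.
  apply: (multilinear0 (i := i) (multilinear_omega _)).
  by rewrite /u' dfwithE eqxx.
rewrite -E tgt_unit; congr (omega p _); apply/funext => j.
by rewrite /u' dfwithE; case: eqP => [->|_]; [exact: wi|exact: esym (Hu j)].
Qed.

(** The vectors are replaced one at a time. *)
Let omega_normal p v w : (forall i, normal_eq p (v i) (w i)) ->
  omega p v = omega p w.
Proof.
move=> vw; pose mix (s : seq 'I_k) j := if j \in s then v j else w j.
suff H s : omega p (mix s) = omega p w.
  rewrite -(H (enum 'I_k)); congr (omega p _); apply/funext => j.
  by rewrite /mix mem_enum.
elim: s => [|j s IH]; first by congr (omega p _).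
rewrite -{}IH; have [js|js] := boolP (j \in s).
  apply: (congr1 (omega p)); apply/funext => l; rewrite /mix inE.
  by have [->|_] := eqVneq l j; rewrite ?js.
have [a [Aa Ea]] := vw j.
have Ew : dfwith (mix s) j (w j) = mix s.
  by rewrite -[RHS](dfwith_id _ j) {3}/mix (negbTE js).
rewrite -[in RHS]Ew.
have -> : mix (j :: s) = dfwith (mix s) j (1 *: anchor p a + w j).
  apply/funext => l; rewrite dfwithE /mix inE scale1r -Ea subrK.
  by have [->|_] := eqVneq l j.
have N : omega p (dfwith (mix s) j (anchor p a)) = 0.
  by apply: (anchor_null (i := j) Aa); rewrite dfwithE eqxx.
apply: etrans (multilinear_omega p _ _ 1 _ _) _; rewrite N mulr0.
exact: add0r.
Qed.

(** Together with basic_pullback: a form is basic if and only if its pullbacks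
    along src and tgt agree. In this shape basic forms are preserved by every
    operation that commutes with pullbacks. *)
Lemma pullback_basic : basic omega.
Proof.
split; [exact: fo|exact: (null_horizontal anchor_null)|].
move=> g v w act.
have [gamma Hgamma] := fin_all_exists act.
pose u i : 'rV[R]_(mdim (arrs G)) := velocity (gamma i).
have -> : omega (src g) v = omega (src g) (fun i => tmap (@src R G) g (u i)).
  apply: esym; apply: omega_normal => i; have [sg g0 N _] := Hgamma i.
  move: N; rewrite -[velocity _]/(velocity (@src R G \o gamma i)).
  by rewrite (velocity_comp sg (smooth_src _)) g0.
rewrite -[RHS]/(pullback (@src R G) omega g u) st.
apply: esym; apply: omega_normal => i; have [sg g0 _ N] := Hgamma i.
move: N; rewrite -[velocity _]/(velocity (@tgt R G \o gamma i)).
by rewrite (velocity_comp sg (smooth_tgt _)) g0.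
Qed.

End Descent.
End BasicForms.

(** * Weak equivalences *)

Section PullbackSmooth.
Context {R : realType}.
Implicit Types M N P : manifold R.

Lemma pullback_compE M N P k (f : M -> N) (g : N -> P) (omega : preform P k) :
  smooth_map f -> smooth_map g ->
  pullback (g \o f) omega = pullback f (pullback g omega).
Proof. by move=> sf sg; apply/funext => p; apply: pullback_comp. Qed.

Lemma smooth_map_comp M N P (f : M -> N) (g : N -> P) :
  smooth_map f -> smooth_map g -> smooth_map (g \o f).
Proof. by move=> sf sg p; exact: smooth_map_at_comp (sf p) (sg (f p)). Qed.

Lemma pullback_square M N N' P k (f : M -> N) (g : N -> P) (f' : M -> N')
    (g' : N' -> P) (omega : preform P k) :
  smooth_map f -> smooth_map g -> smooth_map f' -> smooth_map g' ->
  (forall x, g (f x) = g' (f' x)) ->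
  pullback f (pullback g omega) = pullback f' (pullback g' omega).
Proof.
move=> sf sg sf' sg' E; apply: etrans (esym (pullback_compE omega sf sg)) _.
apply: etrans _ (pullback_compE omega sf' sg').
exact: (congr1 (fun h => pullback h omega) (funext E)).
Qed.

Lemma pullback_id M k (omega : preform M k) : pullback id omega = omega.
Proof.
apply/funext => p; apply/funext => v; rewrite /pullback.
by apply: (congr1 (omega p)); apply/funext => i; exact: tmap_id.
Qed.

(** Every family of tangent vectors at theta x lifts along theta. *)
Lemma pullback_inj_at M N k (theta : M -> N) x (alpha beta : preform N k) :
  (forall v, exists u, tmap theta x u = v) ->
  pullback theta alpha x = pullback theta beta x ->
  alpha (theta x) = beta (theta x).
Proof.
move=> surj E; apply/funext => w.
have [u Hu] := fin_all_exists (fun j => surj (w j)).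
rewrite -(funext Hu : (fun j => tmap theta x (u j)) = w).
exact: (congr1 (fun h => h u) E).
Qed.

Lemma pullback_inj M N k (e : M -> N) (alpha beta : preform N k) :
  submersion e -> (forall q, exists z, e z = q) ->
  pullback e alpha = pullback e beta -> alpha = beta.
Proof.
move=> [_ surj_e] onto_e E; apply/funext => q; have [z <-] := onto_e q.
apply: (pullback_inj_at (surj_e z)).
exact: (congr1 (fun gamma => gamma z) E).
Qed.

End PullbackSmooth.

Section SmoothMul.
Context {R : realType} (G : lie_groupoid R).

(** The pair (a, b) is a smooth map into any fiber product on which the
    multiplication is smooth. *)
Lemma smooth_mul (Q : manifold R) (a b : Q -> arrs G) :
  smooth_map a -> smooth_map b -> (forall x, src (a x) = tgt (b x)) ->
  smooth_map (fun x => mul (a x) (b x)).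
Proof.
move=> sa sb ab; have [P [p1 [p2 [[_ _ _ univ] sm]]]] := mul_smooth G.
have [h [[sh h1 h2] _]] := univ Q a b sa sb ab.
have -> : (fun x => mul (a x) (b x)) = (fun z => mul (p1 z) (p2 z)) \o h.
  by apply/funext => x /=; rewrite h1 h2.
exact: smooth_map_comp sh sm.
Qed.

Lemma smooth_inv (Q : manifold R) (a : Q -> arrs G) :
  smooth_map a -> smooth_map (fun x => inv_arr (a x)).
Proof. by move=> sa; exact: smooth_map_comp sa (@inv_smooth R G). Qed.

End SmoothMul.

Section WeakEquivalence.
Context {R : realType} {K G : lie_groupoid R} (f : lie_morphism K G).
Notation f0 := (on_objs f).
Notation f1 := (on_arrs f).

Let sf0 : smooth_map f0. Proof. exact: on_objs_smooth. Qed.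
Let sf1 : smooth_map f1. Proof. exact: on_arrs_smooth. Qed.

Let smooth_src (A : lie_groupoid R) : smooth_map (@src R A).
Proof. by have [] := src_submersion A. Qed.
Let smooth_tgt (A : lie_groupoid R) : smooth_map (@tgt R A).
Proof. by have [] := tgt_submersion A. Qed.

Lemma pullback_preserves_basic k (omega : preform (objs G) k) :
  basic omega -> basic (pullback f0 omega).
Proof.
move=> bo; have [fo _ _] := bo; apply: pullback_basic.
  exact: pullback_is_form sf0 fo.
apply: etrans
    (pullback_square omega (@smooth_src K) sf0 sf1 (@smooth_src G) _) _.
  by move=> g; rewrite src_morph.
apply: etrans (congr1 (pullback f1) (basic_pullback bo)) _.
apply: pullback_square sf1 (@smooth_tgt G) (@smooth_tgt K) sf0 _.
by move=> g; exact: tgt_morph.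
Qed.

Section Correspondence.
Variables (P : manifold R) (p1 : P -> arrs G) (p2 : P -> objs K).
Hypotheses (fiber_P : is_fiber_product (@src R G) f0 p1 p2)
  (subm_e : submersion (fun z => tgt (p1 z)))
  (onto_e : forall q, exists z, tgt (p1 z) = q)
  (ff : fully_faithful f).

Let e := fun z : P => tgt (p1 z).
Let sp1 : smooth_map p1. Proof. by have [] := fiber_P. Qed.
Let sp2 : smooth_map p2. Proof. by have [] := fiber_P. Qed.
Let p12 z : src (p1 z) = f0 (p2 z). Proof. by have [] := fiber_P. Qed.
Let se : smooth_map e. Proof. by have [] := subm_e. Qed.

(** P is mapped to the objects of G by e and to those of K by p2; pullbacks to
    it compare the forms on both sides. *)
Definition related k (omega : preform (objs G) k) (eta : preform (objs K) k) :=
  pullback e omega = pullback p2 eta.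

Lemma related_inj k (omega omega' : preform (objs G) k) eta :
  related omega eta -> related omega' eta -> omega = omega'.
Proof. by rewrite /related => <- E; apply: pullback_inj subm_e onto_e _. Qed.

Lemma related_dR k (omega : preform (objs G) k) eta :
  is_form omega -> is_form eta -> related omega eta ->
  related (dR omega) (dR eta).
Proof.
move=> fo fe E; apply: etrans (esym (dR_pullback se fo)) _.
apply: etrans (congr1 (fun alpha => dR alpha) E) _.
exact: dR_pullback sp2 fe.
Qed.

(** Here e is tgt o p1 while f0 o p2 is src o p1, and omega has the same
    pullback along src and tgt. *)
Lemma related_pullback k (omega : preform (objs G) k) :
  basic omega -> related omega (pullback f0 omega).
Proof.
move=> bo; apply: etrans (pullback_compE omega sp1 (@smooth_tgt G)) _.
apply: etrans (congr1 (pullback p1) (esym (basic_pullback bo))) _.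
exact: pullback_square sp1 (@smooth_src G) sp2 sf0 p12.
Qed.

(** Pull the relation back along the map x |-> (unit of f0 x, x) to P, whose
    composites with e and p2 are f0 and the identity. *)
Lemma pullback_related k (omega : preform (objs G) k) eta :
  related omega eta -> pullback f0 omega = eta.
Proof.
move=> E; have [_ _ _ univ] := fiber_P.
have su : smooth_map (@unit_arr R G \o f0).
  exact: smooth_map_comp sf0 (@unit_smooth R G).
have sid : smooth_map (id : objs K -> objs K) by exact: smooth_map_at_id.
have [h [[sh h1 h2] _]] := univ _ _ _ su sid (fun x => src_unit (f0 x)).
have <- : e \o h = f0 by apply/funext => x; rewrite /e /= h1 /= tgt_unit.
apply: etrans (pullback_compE omega sh se) _.
apply: etrans (congr1 (pullback h) E) _.
apply: etrans (esym (pullback_compE eta sh sp2)) _.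
have -> : p2 \o h = id by apply/funext.
exact: pullback_id.
Qed.

(** Arrows of G act on P: for z over src g, the point (p1 z, p2 z) is moved to
    (g p1 z, p2 z), which lies over tgt g and has the same image under p2. So
    the pullbacks of omega along src and tgt are both the pullback of eta along
    p2. For tangent vectors this is performed along a parametrization theta of
    the arrows near g and a lift c of their sources to P. *)
Lemma related_basic k (omega : preform (objs G) k) eta :
  is_form omega -> related omega eta -> basic omega.
Proof.
move=> fo E; apply: pullback_basic fo _; apply/funext => g.
have [z ez] := onto_e (src g).
have [U [sigma [oU Uz _ ssigma sigmaK]]] := local_section z subm_e.
have nU : \forall h \near g, U (src h).
  have [cs _] := smooth_src g; apply: cs; apply: near_open => //.
  by rewrite -ez.
have [theta [stheta theta0 thetaU surj]] := local_parametrization nU.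
pose c x := sigma (src (theta x)).
have sst : smooth_map (@src R G \o theta).
  exact: smooth_map_comp stheta (@smooth_src G).
have sc : smooth_map c.
  by move=> x; exact: smooth_map_at_comp (sst x) (ssigma _ (thetaU x)).
have ec x : src (theta x) = tgt (p1 (c x)) by rewrite [RHS]sigmaK.
have sm := smooth_mul stheta (smooth_map_comp sc sp1) ec.
have [_ _ _ univ] := fiber_P.
have [|c' [[sc' c'1 c'2] _]] := univ _ _ _ sm (smooth_map_comp sc sp2).
  by move=> x; apply: etrans (src_mul (ec x)) (p12 _).
rewrite -theta0; apply: pullback_inj_at surj _.
apply: (congr1 (fun alpha => alpha _)).
apply: etrans (pullback_square omega stheta (@smooth_src G) sc se ec) _.
apply: etrans (congr1 (pullback c) E) _.
apply: etrans (pullback_square eta sc sp2 sc' sp2 (fun x => esym (c'2 x))) _.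
apply: etrans (congr1 (pullback c') (esym E)) _.
apply: pullback_square sc' se stheta (@smooth_tgt G) _.
by move=> x; rewrite /e c'1 tgt_mul.
Qed.

Section Descent.
Variables (k : nat) (eta : preform (objs K) k).
Hypotheses (b_eta : basic eta).

Let fe : is_form eta. Proof. by have [] := b_eta. Qed.

Definition is_section (U : set (objs G)) (sigma : objs G -> P) :=
  [/\ open U, forall q, U q -> smooth_map_at sigma q &
      forall q, U q -> e (sigma q) = q].

(** Let theta parametrize P near z and let c be its projection to the section.
    The arrows p1 (c x) and p1 (theta x) of G have the same target, so their
    quotient goes from f0 (p2 (theta x)) to f0 (p2 (c x)); by full faithfulness
    it comes from a smooth family of arrows h x of K. As eta has the same
    pullback along src o h = p2 o theta and tgt o h = p2 o c, it has the same
    values on vectors of P and on their projections to the section. *)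
Let section_pullback U sigma z : is_section U sigma -> U (e z) ->
  pullback p2 eta z =
  (fun v => pullback (p2 \o sigma) eta (e z) (fun i => tmap e z (v i))).
Proof.
move=> [oU ssigma sigmaK] Uz.
have nU : \forall y \near z, U (e y).
  by have [ce _] := se z; apply: ce; exact: near_open.
have [theta [stheta theta0 thetaU surj]] := local_parametrization nU.
have set_ : smooth_map (e \o theta) := smooth_map_comp stheta se.
pose c := sigma \o (e \o theta).
have sc : smooth_map c.
  by move=> x; exact: smooth_map_at_comp (set_ x) (ssigma _ (thetaU x)).
have ec x : e (c x) = e (theta x) := sigmaK _ (thetaU x).
pose a x := mul (inv_arr (p1 (c x))) (p1 (theta x)).
have ax x : src (inv_arr (p1 (c x))) = tgt (p1 (theta x)).
  by apply: etrans (src_inv _) (ec x).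
have sa : smooth_map a.
  exact: smooth_mul (smooth_inv (smooth_map_comp sc sp1))
    (smooth_map_comp stheta sp1) ax.
have spt : smooth_map (p2 \o theta) := smooth_map_comp stheta sp2.
have spc : smooth_map (p2 \o c) := smooth_map_comp sc sp2.
have a_src x : src (a x) = f0 ((p2 \o theta) x) 
  by apply: etrans (src_mul (ax x)) (p12 _).
have a_tgt x : tgt (a x) = f0 ((p2 \o c) x) 
  by apply: etrans (tgt_mul (ax x)) _; apply: etrans (tgt_inv _) (p12 _).
have [h [[sh _ h_src h_tgt] _]] := ff sa spt spc a_src a_tgt.
have E : pullback theta (pullback p2 eta) = pullback (p2 \o c) eta.
  apply: etrans (pullback_square eta stheta sp2 sh (@smooth_src K) _) _.
    by move=> x; rewrite h_src.
  apply: etrans (congr1 (pullback h) (basic_pullback b_eta)) _.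
  apply: etrans (esym (pullback_compE eta sh (@smooth_tgt K))) _.
  exact: (congr1 (fun m => pullback m eta) (funext h_tgt)).
rewrite -theta0.
pose beta : preform P k := fun y v =>
  pullback (p2 \o sigma) eta (e y) (fun i => tmap e y (v i)).
apply: (@pullback_inj_at _ _ _ _ theta _ _ beta) surj _.
apply: etrans (congr1 (fun alpha => alpha _) E) _; apply/funext => u.
have sps : smooth_map_at (p2 \o sigma) ((e \o theta) (0 : 'rV[R]_(mdim P))).
  exact: smooth_map_at_comp (ssigma _ (thetaU _)) (sp2 _).
apply: etrans (congr1 (fun h => h u) (pullback_comp eta (set_ _) sps)) _.
apply: (congr1 (eta _)); apply/funext => i.
by apply: (congr1 (tmap _ _)); exact: tmap_comp (stheta _) (se _).
Qed.

Let exists_section_at q : exists Us : set (objs G) * (objs G -> P),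
  is_section Us.1 Us.2 /\ Us.1 q.
Proof.
have [z <-] := onto_e q.
have [U [sigma [oU Uz _ ssigma sigmaK]]] := local_section z subm_e.
by exists (U, sigma).
Qed.

Let dom_at q := (projT1 (cid (exists_section_at q))).1.
Let sigma_at q := (projT1 (cid (exists_section_at q))).2.
Let sigma_atP q : is_section (dom_at q) (sigma_at q).
Proof. by have [] := projT2 (cid (exists_section_at q)). Qed.
Let dom_atP q : dom_at q q.
Proof. by have [] := projT2 (cid (exists_section_at q)). Qed.

(** The section is chosen anew for each q; by section_pullback the value at q
    is the same for all sections defined at q, which gives smoothness. *)
Let descended : preform (objs G) k :=
  fun q => pullback (p2 \o sigma_at q) eta q.

Let descended_related : related descended eta.
Proof.
apply/funext => z.
exact: esym (section_pullback (sigma_atP (e z)) (dom_atP (e z))).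
Qed.

Let smooth_p2_sigma U sigma q : is_section U sigma -> U q ->
  smooth_map_at (p2 \o sigma) q.
Proof. by move=> [_ ss _] Uq; exact: smooth_map_at_comp (ss q Uq) (sp2 _). Qed.

(** Write a vector at q as the e-image of its image under sigma and use
    descended_related. *)
Let descendedE U sigma q : is_section U sigma -> U q ->
  descended q = pullback (p2 \o sigma) eta q.
Proof.
move=> S Uq; have [oU ss sK] := S; apply/funext => w.
rewrite (pullback_comp eta (ss q Uq) (sp2 _)).
rewrite -descended_related -(pullback_comp _ (ss q Uq) (se _)).
have nK : \forall y \near q, id y = (e \o sigma) y.
  by apply: filterS (near_open oU Uq) => y /sK.
rewrite /pullback /= sK //; apply: (congr1 (descended q)); apply/funext => i.
by rewrite -(near_eq_tmap _ nK (smooth_map_at_id q)) tmap_id.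
Qed.

Let descended_form : is_form descended.
Proof.
split=> [q|c v ac].
  by apply: pullback_alternating; have [] := fe.
apply: (@smooth_at_on _ _ R^o) => x cx; rewrite -(bwdK cx).
set q0 := bwd c x; have S := sigma_atP q0; have Uq0 := dom_atP q0.
have [oU _ _] := S.
have nU : \forall q \near q0, dom_at q0 q by exact: near_open.
have ns : \forall q \near q0, smooth_map_at (p2 \o sigma_at q0) q.
  by apply: filterS nU => q Uq; exact: smooth_p2_sigma S Uq.
have cq0 : dom c q0 := bwd_dom cx.
apply: smooth_at_ext _ (smooth_local_pullback fe ns ac (chart_at_atlas _)
  cq0 (chart_at_dom _) v).
apply: filterS (near_chart cq0 nU) => y [_ Uy].
by rewrite /local_form (descendedE S Uy).
Qed.

(** The local pullbacks of eta along p2 o sigma, for sections sigma of e, agree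
    and form a global form. *)
Lemma basic_descends : exists2 omega : preform (objs G) k,
  basic omega & related omega eta.
Proof.
exists descended; last exact: descended_related.
exact: related_basic descended_form descended_related.
Qed.

End Descent.
End Correspondence.
End WeakEquivalence.

(** * Basic cohomology *)

Section ExactForms.
Context {R : realType}.

Definition exact_basic (G : lie_groupoid R) (k : nat) :
    preform (objs G) k -> Prop :=
  match k with
  | 0 => fun omega => omega = 0
  | k'.+1 => fun omega => exists2 beta : preform (objs G) k',
      basic beta & omega = dR beta
  end.

Lemma coboundariesE (G : lie_groupoid R) k (z : cocycle G k) :
  (z \in @coboundaries R G k) = `[< exact_basic (\val z) >].
Proof. by case: k z. Qed.

Lemma cocycleP (G : lie_groupoid R) k (z : cocycle G k) :
  basic (\val z) /\ dR (\val z) = 0.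
Proof. exact/asboolP/(valP z). Qed.

Variables (K G : lie_groupoid R) (f : lie_morphism K G).
Hypothesis we : weak_equivalence f.
Notation f0 := (on_objs f).

Lemma dR_pullback_basic k (omega : preform (objs G) k) : basic omega ->
  dR (pullback f0 omega) = pullback f0 (dR omega).
Proof. by move=> [fo _ _]; exact: dR_pullback (@on_objs_smooth _ _ _ f) fo. Qed.

Lemma pullback_basic_inj k (omega omega' : preform (objs G) k) :
  basic omega -> basic omega' -> pullback f0 omega = pullback f0 omega' ->
  omega = omega'.
Proof.
have [[P [p1 [p2 [fiber_P subm_e onto_e]]]] _] := we.
move=> b b' E; have r := related_pullback fiber_P b.
have r' := related_pullback fiber_P b'; rewrite -E in r'.
exact: (related_inj subm_e onto_e r r').
Qed.

Lemma pullback_basic_surj k (eta : preform (objs K) k) : basic eta ->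
  exists2 omega, basic omega & pullback f0 omega = eta.
Proof.
have [[P [p1 [p2 [fiber_P subm_e onto_e]]]] ff] := we.
move=> b; have [omega bo r] := basic_descends fiber_P subm_e onto_e ff b.
by exists omega => //; exact: (pullback_related fiber_P subm_e r).
Qed.

(** Both dR omega and 0 are related to 0, and related forms determine each
    other. *)
Lemma closed_pullback k (omega : preform (objs G) k) : basic omega ->
  dR (pullback f0 omega) = 0 -> dR omega = 0.
Proof.
have [[P [p1 [p2 [fiber_P subm_e onto_e]]]] _] := we.
move=> bo d0; have [fo _ _] := bo.
have [fp _ _] := pullback_preserves_basic f bo.
have r := related_dR fiber_P subm_e fo fp (related_pullback fiber_P bo).
have r0 : related p1 p2 0 (0 : preform (objs K) k.+1) by [].
by rewrite d0 in r; exact: (related_inj subm_e onto_e r r0).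
Qed.

(** A primitive of the pullback descends to a primitive by basic_descends. *)
Lemma exact_pullback k (omega : preform (objs G) k) : basic omega ->
  exact_basic (pullback f0 omega) <-> exact_basic omega.
Proof.
have [[P [p1 [p2 [fiber_P subm_e onto_e]]]] ff] := we.
case: k omega => [|k] omega bo /=.
  split=> [E|->]; last by [].
  by apply: (pullback_basic_inj bo (basic0 G 0)); rewrite E.
split=> [[beta' bb' E]|[beta bb ->]].
  have [beta bb rb] := basic_descends fiber_P subm_e onto_e ff bb'.
  have [fb _ _] := bb; have [fb' _ _] := bb'.
  have ro := related_pullback fiber_P bo; rewrite E in ro.
  have rd := related_dR fiber_P subm_e fb fb' rb.
  by exists beta => //; exact: (related_inj subm_e onto_e ro rd).
exists (pullback f0 beta); first exact: pullback_preserves_basic.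
by rewrite dR_pullback_basic.
Qed.

End ExactForms.

Section Cohomology.
Context {R : realType}.

Lemma bijective_linear_inverse (U V : lmodType R) (h : {linear U -> V}) :
  bijective h -> exists h' : {linear V -> U}, bijective h'.
Proof.
move=> [g hK gK]; have lg : linear g by exact: can2_linear hK gK.
pose gL : {linear V -> U} := HB.pack g (GRing.isLinear.Build _ _ _ _ _ lg).
by exists gL; exists h.
Qed.

Variables (K G : lie_groupoid R) (f : lie_morphism K G).
Hypothesis we : weak_equivalence f.
Variable k : nat.
Notation f0 := (on_objs f).

Let pullback_cocycle (omega : preform (objs G) k) : omega \in @cocycles R G k ->
  pullback f0 omega \in @cocycles R K k.
Proof.
move=> /asboolP[bo d0]; apply/asboolP; split.
  exact: pullback_preserves_basic.
by rewrite dR_pullback_basic // d0.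
Qed.

Let pull (z : cocycle G k) : cocycle K k :=
  @exist _ (fun omega => omega \in @cocycles R K k) _
    (pullback_cocycle (valP z)).

Let pull_linear a (y z : cocycle G k) :
  pull (a *: y + z) = a *: pull y + pull z.
Proof. exact: val_inj. Qed.

Let pullB (y z : cocycle G k) : pull (y - z) = pull y - pull z.
Proof. by rewrite addrC -scaleN1r pull_linear scaleN1r addrC. Qed.

Let pull_coboundary (z : cocycle G k) :
  (pull z \in @coboundaries R K k) = (z \in @coboundaries R G k).
Proof.
rewrite !coboundariesE; apply/asboolP/asboolP; have [bz _] := cocycleP z.
  by move=> /(exact_pullback we bz).
by move=> /(exact_pullback we bz).
Qed.

Let pull_surj (y : cocycle K k) : exists z, pull z = y.
Proof.
have [by_ dy] := cocycleP y.
have [omega bo E] := pullback_basic_surj we by_.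
have co : omega \in @cocycles R G k.
  by apply/asboolP; split=> //; apply: (closed_pullback we bo); rewrite E.
exists (@exist _ (fun omega => omega \in @cocycles R G k) _ co : cocycle G k).
exact: val_inj.
Qed.

Notation piG := (quot_pi (@coboundaries_submod R G k)).
Notation piK := (quot_pi (@coboundaries_submod R K k)).

(** Pullback along on_objs f is a bijection of basic forms that commutes with dR
    and reflects closed and exact forms. *)
Lemma weak_equivalence_cohomology :
  exists F : {linear basic_cohomology G k -> basic_cohomology K k}, bijective F.
Proof.
pose F (x : basic_cohomology G k) : basic_cohomology K k :=
  piK (pull (projT1 (cid (quot_ind x)))).
have FE z : F (piG z) = piK (pull z).
  rewrite /F; case: cid => z' /= E.
  apply/quot_piP; rewrite -pullB pull_coboundary.
  by apply/(@quot_piP _ _ _ (@coboundaries_submod R G k)); rewrite E.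
have lF : linear F.
  move=> a x y; have [x' ->] := quot_ind x; have [y' ->] := quot_ind y.
  rewrite -[a *: piG x']/(quot_scale a (piG x')) -quot_piZ -quot_piD !FE.
  by rewrite pull_linear quot_piD quot_piZ.
have injF : injective F.
  move=> x y; have [x' ->] := quot_ind x; have [y' ->] := quot_ind y.
  rewrite !FE => /quot_piP; rewrite -pullB pull_coboundary => H.
  by apply/quot_piP.
have surjF y : exists x, F x = y.
  have [y' ->] := quot_ind y; have [z <-] := pull_surj y'.
  by exists (piG z).
pose g y := projT1 (cid (surjF y)).
have gK : cancel g F by move=> y; exact: projT2 (cid (surjF y)).
pose FL : {linear basic_cohomology G k -> basic_cohomology K k} :=
  HB.pack F (GRing.isLinear.Build _ _ _ _ _ lF).
exists FL; exists g => // x.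
by apply: injF; rewrite gK.
Qed.

End Cohomology.

Theorem corollary8p4 (R : realType) (G H : lie_groupoid R) :
  morita_equivalent G H ->
  forall k : nat,
    exists f : {linear basic_cohomology G k -> basic_cohomology H k},
      bijective f.
Proof.
move=> [K [f [f' [wf wf']]]] k.
have [F bF] := weak_equivalence_cohomology wf k.
have [F' bF'] := weak_equivalence_cohomology wf' k.
have [I bI] := bijective_linear_inverse bF'.
by exists (I \o F); exact: bij_comp bI bF.
Qed.
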